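(* For every group $G$ we have $\underline{\mathrm{hd}}(G)\leq \underline{\mathrm{cd}}(G)$.
   Context: For a group $G$, the generalized homological dimension and the generalized cohomological dimension (Ikenaga) are $$\underline{\mathrm{hd}}(G)=\sup\{i:\ \mathrm{Tor}_i^{\mathbb{Z}G}(I,M)\neq 0,\ M\ \mathbb{Z}\text{-torsion free},\ I\ \text{injective}\},$$ $$\underline{\mathrm{cd}}(G)=\sup\{i:\ \mathrm{Ext}^i_{\mathbb{Z}G}(M,F)\neq 0,\ M\ \mathbb{Z}\text{-free},\ F\ \text{free}\},$$ where $M$ ranges over $\mathbb{Z}G$-modules whose underlying abelian group is torsion free (resp. free), $I$ over injective (right) $\mathbb{Z}G$-modules, and $F$ over free $\mathbb{Z}G$-modules. The values lie in $\mathbb{N}\cup\{\infty\}$. *)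

(* Defs.v *)
From HB Require Import structures.
From mathcomp Require Import all_boot all_order all_algebra.
From mathcomp Require Import finmap.
From mathcomp.multinomials Require Import monalg.
From mathcomp Require Import boolp classical_sets functions constructive_ereal.

Set Implicit Arguments.
Unset Strict Implicit.
Unset Printing Implicit Defensive.

Import Order.TTheory GRing.Theory Num.Theory.

Local Open Scope fset_scope.
Local Open Scope ring_scope.

(* All modules over [R : nzRingType] are left modules, [lmodType R].  Right
   modules are left modules over the converse ring, [lmodType R^c]: for
   [x : I] and [r : R], the element written [x r] on paper is
   [(r : R^c) *: x]. *)

Definition group_ring (G : groupType) : Type := {malg int[G]}.
HB.instance Definition _ (G : groupType) :=
  GRing.Zmodule.on (group_ring G).

Section GroupRing.
Variable G : groupType.
Implicit Types x y z : {malg int[G]}.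

Definition gr_one : {malg int[G]} := << 1 *g (1%g : G) >>.

Definition gr_mul x y : {malg int[G]} :=
  \sum_(k <- msupp x) \sum_(l <- msupp y) << x@_k * y@_l *g (k * l)%g >>.

Lemma gr_mulw (d e : {fset G}) x y : msupp x `<=` d -> msupp y `<=` e ->
  gr_mul x y = \sum_(k <- d) \sum_(l <- e) << x@_k * y@_l *g (k * l)%g >>.
Proof.
move=> le_d le_e; rewrite /gr_mul (big_fset_incl _ le_d) /=.
  apply/eq_bigr=> k _; apply/big_fset_incl => // l _ /mcoeff_outdom ->.
  by rewrite mulr0 monalgU0.
move=> k _ /mcoeff_outdom xk.
by rewrite big1 => // l _; rewrite xk mul0r monalgU0.
Qed.

Lemma gr_mulUU (a b : int) (k l : G) :
  gr_mul << a *g k >> << b *g l >> = << a * b *g (k * l)%g >>.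
Proof. by rewrite (gr_mulw msuppU_le msuppU_le) !big_seq_fset1 !mcoeffUU. Qed.

Lemma gr_mulDl : left_distributive gr_mul +%R.
Proof.
move=> x y z; rewrite (gr_mulw (msuppD_le _ _) (fsubset_refl _)).
rewrite (gr_mulw (fsubsetUl _ (msupp y)) (fsubset_refl (msupp z))).
rewrite (gr_mulw (fsubsetUr (msupp x) _) (fsubset_refl (msupp z))).
rewrite -big_split; apply/eq_bigr=> k _.
rewrite -big_split; apply/eq_bigr=> l _.
by rewrite mcoeffD mulrDl monalgUD.
Qed.

Lemma gr_mulDr : right_distributive gr_mul +%R.
Proof.
move=> z x y; rewrite (gr_mulw (fsubset_refl _) (msuppD_le _ _)).
rewrite (gr_mulw (fsubset_refl (msupp z)) (fsubsetUl _ (msupp y))).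
rewrite (gr_mulw (fsubset_refl (msupp z)) (fsubsetUr (msupp x) _)).
rewrite -big_split; apply/eq_bigr=> k _.
rewrite -big_split; apply/eq_bigr=> l _.
by rewrite mcoeffD mulrDr monalgUD.
Qed.

Lemma gr_mul0l x : gr_mul 0 x = 0.
Proof. by rewrite /gr_mul msupp0 big_seq_fset0. Qed.

Lemma gr_mul0r x : gr_mul x 0 = 0.
Proof. by rewrite /gr_mul big1 // => k _; rewrite msupp0 big_seq_fset0. Qed.

Lemma gr_mul_suml (I : Type) (r : seq I) (F : I -> {malg int[G]}) y :
  gr_mul (\sum_(i <- r) F i) y = \sum_(i <- r) gr_mul (F i) y.
Proof.
exact: (big_morph (gr_mul^~ y) (fun _ _ => gr_mulDl _ _ _) (gr_mul0l _)).
Qed.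

Lemma gr_mul_sumr (I : Type) (r : seq I) (F : I -> {malg int[G]}) x :
  gr_mul x (\sum_(i <- r) F i) = \sum_(i <- r) gr_mul x (F i).
Proof.
exact: (big_morph (gr_mul x) (fun _ _ => gr_mulDr _ _ _) (gr_mul0r _)).
Qed.

Lemma gr_mulA : associative gr_mul.
Proof.
move=> x y z; rewrite (monalgE x) !gr_mul_suml; apply/eq_bigr=> k _.
rewrite (monalgE y) gr_mul_suml !gr_mul_sumr gr_mul_suml.
apply/eq_bigr=> l _; rewrite (monalgE z) !gr_mul_sumr.
by apply/eq_bigr=> m _; rewrite !gr_mulUU mulrA mulgA.
Qed.

Lemma gr_mul1l : left_id gr_one gr_mul.
Proof.
move=> x; rewrite {1}(monalgE x) gr_mul_sumr [RHS]monalgE.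
by apply/eq_bigr=> k _; rewrite gr_mulUU mul1r mul1g.
Qed.

Lemma gr_mul1r : right_id gr_one gr_mul.
Proof.
move=> x; rewrite {1}(monalgE x) gr_mul_suml [RHS]monalgE.
by apply/eq_bigr=> k _; rewrite gr_mulUU mulr1 mulg1.
Qed.

Lemma gr_one_neq0 : gr_one != 0.
Proof. by rewrite monalgU_eq0 oner_eq0. Qed.

HB.instance Definition _ := GRing.Zmodule_isNzRing.Build (group_ring G)
  gr_mulA gr_mul1l gr_mul1r gr_mulDl gr_mulDr gr_one_neq0.

End GroupRing.

(* [{malg R[X]}] is the free left [R]-module on the set [X]. *)
Section LinearExtension.
Variables (R : nzRingType) (X : choiceType) (V : lmodType R) (f : X -> V).

Definition lin_ext (c : {malg R[X]}) : V := \sum_(x <- msupp c) c@_x *: f x.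

Lemma lin_extw (d : {fset X}) (c : {malg R[X]}) : msupp c `<=` d ->
  lin_ext c = \sum_(x <- d) c@_x *: f x.
Proof.
move=> le_d; rewrite /lin_ext (big_fset_incl _ le_d) //= => x _ /mcoeff_outdom.
by move=> ->; rewrite scale0r.
Qed.

Lemma lin_ext_is_linear : linear lin_ext.
Proof.
move=> a c c'; pose d := msupp c `|` msupp c' `|` msupp (a *: c + c').
have le_c : msupp c `<=` d by rewrite /d -fsetUA fsubsetUl.
have le_c' : msupp c' `<=` d.
  by apply: (fsubset_trans (fsubsetUr (msupp c) _)); apply: fsubsetUl.
have le_s : msupp (a *: c + c') `<=` d by apply: fsubsetUr.
rewrite (lin_extw le_c) (lin_extw le_c') (lin_extw le_s).
rewrite scaler_sumr -big_split; apply/eq_bigr=> x _.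
by rewrite mcoeffD mcoeffZ scalerDl scalerA.
Qed.

HB.instance Definition _ :=
  GRing.isLinear.Build R {malg R[X]} V *:%R lin_ext lin_ext_is_linear.

Lemma lin_extU (a : R) (x : X) : lin_ext << a *g x >> = a *: f x.
Proof. by rewrite (lin_extw msuppU_le) big_seq_fset1 mcoeffUU. Qed.

End LinearExtension.

Definition free_module (R : nzRingType) (M : lmodType R) : Prop :=
  exists (X : choiceType) (f : {linear {malg R[X]} -> M}), bijective f.

Definition injective_module (R : nzRingType) (I : lmodType R) : Prop :=
  forall (A B : lmodType R) (f : {linear A -> B}) (g : {linear A -> I}),
    injective f -> exists h : {linear B -> I}, forall a, h (f a) = g a.

Definition Z_free (M : zmodType) : Prop :=
  free_module (zmodule M : lmodType int).

Definition Z_torsion_free (M : zmodType) : Prop :=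
  forall (n : nat) (x : M), x *+ n = 0 -> n = 0%N \/ x = 0.

Section LinearKernel.
Variables (R : nzRingType) (U V : lmodType R) (f : {linear U -> V}).

Definition lkerp : {pred U} := fun u => f u == 0.

Lemma lkerp_submod_closed : submod_closed lkerp.
Proof.
split; first by rewrite unfold_in linear0.
move=> a u v; rewrite !unfold_in linearP => /eqP -> /eqP ->.
by rewrite scaler0 addr0.
Qed.

HB.instance Definition _ :=
  GRing.isSubmodClosed.Build R U lkerp lkerp_submod_closed.

Definition lker : Type := {u : U | lkerp u}.

HB.instance Definition _ := SubChoice.on lker.
HB.instance Definition _ := [SubChoice_isSubLmodule of lker by <:].

End LinearKernel.

Section AdditiveKernel.
Variables (U V : zmodType) (f : {additive U -> V}).

Definition zkerp : {pred U} := fun u => f u == 0.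

Lemma zkerp_zmod_closed : zmod_closed zkerp.
Proof.
split; first by rewrite unfold_in raddf0.
by move=> u v; rewrite !unfold_in raddfB => /eqP -> /eqP ->; rewrite subr0.
Qed.

HB.instance Definition _ := GRing.isZmodClosed.Build U zkerp zkerp_zmod_closed.

Definition zker : Type := {u : U | zkerp u}.

HB.instance Definition _ := SubChoice.on zker.
HB.instance Definition _ := [SubChoice_isSubZmodule of zker by <:].

End AdditiveKernel.

Section GeneratedSubgroup.
Variables (V : zmodType) (S : set V).

Definition zspanp : {pred V} := fun v =>
  `[< forall K : {pred V}, zmod_closed K -> (forall s, S s -> s \in K) ->
        v \in K >].

Lemma zspanp_zmod_closed : zmod_closed zspanp.
Proof.
split; first by apply/asboolP => K [].
move=> u v /asboolP Su /asboolP Sv; apply/asboolP => K cK SK.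
by apply: cK.2; [exact: Su | exact: Sv].
Qed.

HB.instance Definition _ :=
  GRing.isZmodClosed.Build V zspanp zspanp_zmod_closed.

Lemma zspanp_gen s : S s -> s \in zspanp.
Proof. by move=> Ss; apply/asboolP => K _ SK; apply: SK. Qed.

Lemma zspanp_kernel (W : zmodType) (h : {additive V -> W}) :
  (forall s, S s -> h s = 0) -> forall v, v \in zspanp -> h v = 0.
Proof.
move=> hS v /asboolP /(_ (zkerp h) (zkerp_zmod_closed h)) hv; apply/eqP/hv.
by move=> s /hS hs; rewrite unfold_in hs.
Qed.

End GeneratedSubgroup.

(* For [A -f-> B -g-> C] with [g \o f = 0], the group [ker g / im f]. *)
Section Homology.
Variables (A B C : zmodType) (f : {additive A -> B}) (g : {additive B -> C}).

Definition boundary : {pred zker g} := fun z => `[< exists a, f a = val z >].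

Lemma boundary_zmod_closed : zmod_closed boundary.
Proof.
split; first by apply/asboolP; exists 0; rewrite !raddf0.
move=> z w /asboolP[a fa] /asboolP[b fb]; apply/asboolP.
by exists (a - b); rewrite !raddfB fa fb.
Qed.

HB.instance Definition _ :=
  GRing.isZmodClosed.Build (zker g) boundary boundary_zmod_closed.

Definition homology : zmodType := @Quotient.quot (zker g) boundary.

End Homology.

Definition zmod_nonzero (V : zmodType) : Prop := exists v : V, v != 0.

Section Tensor.
Variables (R : nzRingType) (I : lmodType R^c).

Inductive tensor_rel (M : lmodType R) : set {malg int[(I * M)%type]} :=
| tensor_relDl x x' m : tensor_rel
    (<< (x + x', m) >> - << (x, m) >> - << (x', m) >>)
| tensor_relDr x m m' : tensor_rel
    (<< (x, m + m') >> - << (x, m) >> - << (x, m') >>)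
| tensor_relZ x (r : R) m : tensor_rel
    (<< ((r : R^c) *: x, m) >> - << (x, r *: m) >>).

Definition tensor (M : lmodType R) : zmodType :=
  @Quotient.quot {malg int[(I * M)%type]} (zspanp (@tensor_rel M)).

Definition tens (M : lmodType R) (x : I) (m : M) : tensor M :=
  \pi_(tensor M)%qT << (x, m) >>.

Lemma tens_eq (M : lmodType R) (u v : {malg int[(I * M)%type]}) :
  tensor_rel (u - v) -> \pi_(tensor M)%qT u = \pi_(tensor M)%qT v.
Proof. by move=> uv; apply/eqP; rewrite -Quotient.idealrBE zspanp_gen. Qed.

Lemma tensDl (M : lmodType R) x x' (m : M) :
  tens (x + x') m = tens x m + tens x' m.
Proof.
rewrite -[RHS](raddfD \pi_(tensor M)%qT); apply: tens_eq.
by rewrite opprD addrA; apply: tensor_relDl.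
Qed.

Lemma tensDr (M : lmodType R) x (m m' : M) :
  tens x (m + m') = tens x m + tens x m'.
Proof.
rewrite -[RHS](raddfD \pi_(tensor M)%qT); apply: tens_eq.
by rewrite opprD addrA; apply: tensor_relDr.
Qed.

Lemma tensZ (M : lmodType R) x (r : R) (m : M) :
  tens ((r : R^c) *: x) m = tens x (r *: m).
Proof. by apply: tens_eq; apply: tensor_relZ. Qed.

Section TensorMap.
Variables (M N : lmodType R) (f : {linear M -> N}).

Definition tensor_pre : {malg int[(I * M)%type]} -> zmodule (tensor N) :=
  lin_ext (fun p => tens p.1 (f p.2) : zmodule (tensor N)).

HB.instance Definition _ := GRing.Linear.on tensor_pre.

Definition tensor_map (t : tensor M) : tensor N := tensor_pre (repr t).

Lemma tensor_preU p : tensor_pre << p >> = tens p.1 (f p.2).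
Proof. by rewrite /tensor_pre lin_extU scale1r. Qed.

Lemma tensor_pre_rel s : tensor_rel s -> tensor_pre s = 0.
Proof.
case=> [x x' m|x m m'|x r m]; rewrite !raddfB /= !tensor_preU /=.
- by rewrite tensDl addrAC addrK subrr.
- by rewrite linearD tensDr addrAC addrK subrr.
- by rewrite linearZ tensZ subrr.
Qed.

Lemma tensor_map_pi u : tensor_map (\pi_(tensor M)%qT u) = tensor_pre u.
Proof.
apply/eqP; rewrite -subr_eq0 -(raddfB tensor_pre); apply/eqP.
apply: (zspanp_kernel tensor_pre_rel).
by rewrite Quotient.idealrBE reprK.
Qed.

Lemma tensor_mapE x m : tensor_map (tens x m) = tens x (f m).
Proof. by rewrite tensor_map_pi tensor_preU. Qed.

Lemma tensor_map_is_zmod_morphism : zmod_morphism tensor_map.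
Proof.
move=> t u; rewrite -[t]reprK -[u]reprK -(raddfB \pi_(tensor M)%qT).
by rewrite !tensor_map_pi raddfB.
Qed.

HB.instance Definition _ := GRing.isZmodMorphism.Build
  (tensor M) (tensor N) tensor_map tensor_map_is_zmod_morphism.

End TensorMap.
End Tensor.

Section Hom.
Variables (R : nzRingType) (M N : lmodType R).

Definition homp : {pred M -> N} := fun h => `[< linear h >].

Lemma homp_zmod_closed : zmod_closed homp.
Proof.
split.
  by apply/asboolP => a x y; rewrite /GRing.zero /= scaler0 addr0.
move=> g h /asboolP gP /asboolP hP; apply/asboolP => a x y /=.
change (g (a *: x + y) - h (a *: x + y) = a *: (g x - h x) + (g y - h y)).
by rewrite gP hP scalerBr opprD addrACA.
Qed.

HB.instance Definition _ :=
  GRing.isZmodClosed.Build (M -> N) homp homp_zmod_closed.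

Definition hom : Type := {h : M -> N | homp h}.

HB.instance Definition _ := SubChoice.on hom.
HB.instance Definition _ := [SubChoice_isSubZmodule of hom by <:].

End Hom.

Section HomMap.
Variables (R : nzRingType) (M M' N : lmodType R) (f : {linear M -> M'}).

Lemma hom_map_subproof (h : hom M' N) : homp (val h \o f).
Proof.
by apply/asboolP => a x y /=; rewrite linearP; move/asboolP: (valP h) => ->.
Qed.

Definition hom_map (h : hom M' N) : hom M N :=
  exist _ (val h \o f) (hom_map_subproof h).

Lemma hom_map_is_zmod_morphism : zmod_morphism hom_map.
Proof. by move=> g h; apply: val_inj. Qed.

HB.instance Definition _ := GRing.isZmodMorphism.Build
  (hom M' N) (hom M N) hom_map hom_map_is_zmod_morphism.

End HomMap.

(* Tor and Ext do not depend on the projective resolution used to compute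
   them.  We fix the canonical free one: [resolution M n] is free on the
   underlying set of the [n]-th syzygy of [M], and the [n.+1]-st syzygy is the
   kernel of the evaluation map from it onto the [n]-th. *)
Section Resolution.
Variable R : nzRingType.

Definition cover (M : lmodType R) : {malg R[M]} -> M := lin_ext (@id M).

HB.instance Definition _ (M : lmodType R) := GRing.Linear.on (@cover M).

Definition syzygy1 (M : lmodType R) : lmodType R := lker (@cover M).

Definition syzygy (M : lmodType R) (n : nat) : lmodType R :=
  iter n syzygy1 M.

Definition resolution (M : lmodType R) (n : nat) : lmodType R :=
  {malg R[syzygy M n]}.

Definition resolution_diff (M : lmodType R) (n : nat) :
    resolution M n.+1 -> resolution M n :=
  fun c => val (@cover (syzygy M n.+1) c).

Lemma resolution_diff_is_linear M n : linear (@resolution_diff M n).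
Proof. by move=> a c c'; rewrite /resolution_diff !linearP. Qed.

HB.instance Definition _ M n := GRing.isLinear.Build R _ _ *:%R
  (@resolution_diff M n) (@resolution_diff_is_linear M n).

Definition augmentation (M : lmodType R) : resolution M 0 -> M := @cover M.

Lemma cover_surj (M : lmodType R) m : exists c, @cover M c = m.
Proof. by exists << m >>; rewrite /cover lin_extU scale1r. Qed.

Lemma augmentation_exact (M : lmodType R) (c : resolution M 0) :
  augmentation c = 0 <-> exists c', resolution_diff c' = c.
Proof.
split=> [/eqP c0|[c' <-]]; last exact/eqP/(valP (cover c')).
have [c' c'E] := cover_surj (exist _ c c0 : syzygy M 1).
by exists c'; rewrite /resolution_diff c'E.
Qed.

Lemma resolution_exact (M : lmodType R) n (c : resolution M n.+1) :
  resolution_diff c = 0 <-> exists c', resolution_diff c' = c.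
Proof.
split=> [c0|[c' <-]].
  have {}c0 : cover c == 0 by apply/eqP/val_inj.
  have [c' c'E] := cover_surj (exist _ c c0 : syzygy M n.+2).
  by exists c'; rewrite /resolution_diff c'E.
have /eqP c'0 := valP (cover c').
by rewrite /resolution_diff c'0.
Qed.

End Resolution.

(* The differential out of [I (x) P_0], resp. into [Hom(P_0, F)], is zero; the
   choice of its other end does not affect the homology. *)
Definition null_map (V : zmodType) : {additive V -> V} := \0.

Definition Tor (R : nzRingType) (i : nat) (I : lmodType R^c) (M : lmodType R) :
    zmodType :=
  match i with
  | 0 => homology (@tensor_map R I _ _ (@resolution_diff R M 0))
                  (null_map (tensor I (resolution M 0)))
  | j.+1 => homology (@tensor_map R I _ _ (@resolution_diff R M j.+1))
                     (@tensor_map R I _ _ (@resolution_diff R M j))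
  end.

Definition Ext (R : nzRingType) (i : nat) (M F : lmodType R) : zmodType :=
  match i with
  | 0 => homology (null_map (hom (resolution M 0) F))
                  (@hom_map R _ _ F (@resolution_diff R M 0))
  | j.+1 => homology (@hom_map R _ _ F (@resolution_diff R M j))
                     (@hom_map R _ _ F (@resolution_diff R M j.+1))
  end.

(* The supremum in [N u {+oo}]; that of the empty set is [0]. *)
Definition sup_nat (S : set nat) : \bar int :=
  supremum 0%:E [set (n%:Z)%:E | n in S]%classic.

Lemma sup_natP (S : set nat) : (S !=set0)%classic ->
  supremums [set (n%:Z)%:E | n in S]%classic (sup_nat S).
Proof.
move=> S0; rewrite /sup_nat /supremum; case: ifPn => [/eqP E0|_].
  by case: S0 => n Sn; have : set0 (n%:Z)%:E by rewrite -E0; exists n.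
suff [z zS] : exists z : \bar int, supremums [set (n%:Z)%:E | n in S]%classic z.
  exact: (xgetI _ zS).
have [[m Sm]|unb] := pselect (exists m, forall n, S n -> (n <= m)%N).
  have exS : exists n, `[< S n >] by case: S0 => n Sn; exists n; apply/asboolP.
  have leS n : `[< S n >] -> (n <= m)%N by move/asboolP/Sm.
  have [k /asboolP Sk kmax] := ex_maxnP exS leS.
  exists (k%:Z)%:E; split=> [_ [n Sn <-]|z]; last by apply; exists k.
  by rewrite lee_fin lez_nat kmax //; apply/asboolP.
exists +oo%E; split=> [z _|[z| |] zS]; rewrite ?leey //; exfalso; last first.
  by case: S0 => n Sn; have := zS _ (ex_intro2 _ _ n Sn erefl).
apply: unb; exists `|z|%N => n Sn.
have := zS _ (ex_intro2 _ _ n Sn erefl); rewrite lee_fin.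
by case: z {zS} => // k; rewrite lez_nat.
Qed.

Definition gen_hd (G : groupType) : \bar int :=
  sup_nat [set i | exists (I : lmodType (group_ring G)^c)
                          (M : lmodType (group_ring G)),
    [/\ injective_module I, Z_torsion_free M & zmod_nonzero (Tor i I M)]].

Definition gen_cd (G : groupType) : \bar int :=
  sup_nat [set i | exists M F : lmodType (group_ring G),
    [/\ Z_free M, free_module F & zmod_nonzero (Ext i M F)]].

(* Main.v *)
From Pilot Require Import Defs.
From HB Require Import structures.
From mathcomp Require Import all_boot all_order all_algebra.
From mathcomp Require Import finmap.
From mathcomp.multinomials Require Import monalg.
From mathcomp Require Import boolp classical_sets functions.
From mathcomp Require Import constructive_ereal.

(** Write [R = Z[G]], and let [n] bound the degrees in which [Ext (L, F)] can be
    nonzero for [L] free over [Z] and [F] free over [R].  The point is that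
    [Tor_i (I, M) = 0] for [i > n], [I] injective and [M] torsion-free.  Every
    injective [I] is a retract of a coinduced module [W^G] with [W] divisible, so
    [I = W^G] may be assumed.

    Torsionless modules.  Over a countable ring, if a nonzero element of
    [I (x) K] died in a free module, injectivity of [I] would produce a sequence of
    linear forms, the [q]-th of which respects the first [q] relations of [K] and
    detects the element.  Vanishing of [Ext] with coefficients in [R^(nat)] allows
    one to correct them to forms on [K] that extend to the free module, changing
    only finitely many of them on the element, and this is a contradiction
    ([countable_Tor_injective]).
    Say that an abelian group is torsionless if it embeds in a power of [Z]; the
    countable ones are free ([countable_torsionless_free]).  An element of [Tor]
    lives over a countable subgroup of [G] and a countable submodule of [L], and
    the hypothesis on [Ext] passes to subgroups by Shapiro's lemma.  Hence
    [Tor_i (I, L) = 0] for [i > n] as soon as [L] is torsionless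
    ([torsionless_Tor]).  Syzygies are torsionless, so this settles [i > n + 1] for
    every [M], and [i = n + 1] remains.

    Rational coefficients.  A torsion-free [M] may contain no invariant lattice, so
    it cannot be replaced by a torsionless module directly.  Instead let
    [Lambda = Z^G].  It is torsionless, and it is the kernel of
    [Q^G -> (Q/Z)^G], where both terms are coinduced from divisible groups;
    together with the previous step this bounds its flat dimension, rationally, by
    [n].  Since [W^G] is a module over the ring [Lambda], the group
    [Ext^(n+1) (M, Hom (W^G, Q))] is a retract of
    [Ext^(n+1) (Lambda, Hom (M (x) W^G, Q))], which vanishes ([rational_Ext]).  By
    duality [Tor_(n+1) (I, M)] is a torsion group.

    Torsion.  For [m > 0] the kernel of [R^(M) -> M / m M] is torsionless, so its
    [Tor_(n+1)] vanishes, and this makes multiplication by [m] injective on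
    [Tor_(n+1) (I, M)] ([Tor1_torsion]).  A torsion group on which every [m] acts
    injectively is zero. *)

Set Implicit Arguments.
Unset Strict Implicit.
Unset Printing Implicit Defensive.

Import Pilot.Defs.
Import Order.TTheory GRing.Theory Num.Theory.

Local Open Scope fset_scope.
Local Open Scope ring_scope.

(** * Abelian groups *)

Definition mk_additive (A B : zmodType) (f : A -> B) (fD : zmod_morphism f) :
    {additive A -> B} :=
  HB.pack f (GRing.isZmodMorphism.Build A B f fD).

Lemma mk_additiveE (A B : zmodType) (f : A -> B) (fD : zmod_morphism f) a :
  mk_additive fD a = f a.
Proof. by []. Qed.

Definition mk_linear (R : nzRingType) (A B : lmodType R) (f : A -> B)
    (fL : linear f) : {linear A -> B} :=
  HB.pack f (GRing.isLinear.Build R A B *:%R f fL).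

Lemma mk_linearE (R : nzRingType) (A B : lmodType R) (f : A -> B)
  (fL : linear f) a : mk_linear fL a = f a.
Proof. by []. Qed.

Definition divisible (W : zmodType) : Prop :=
  forall n (w : W), (0 < n)%N -> exists v, v *+ n = w.

Section DivisibleInjective.
Variables (A B W : zmodType) (f : {additive A -> B}) (g : {additive A -> W}).
Hypotheses (f_inj : injective f) (W_div : divisible W).

(* Partial homomorphisms are handled through their graphs. *)
Let G0 : set (B * W) := [set p | exists a, p = (f a, g a)]%classic.
Let good (S : set (B * W)) : Prop :=
  [/\ (forall p q, S p -> S q -> S (p - q)) & forall w, S (0, w) -> w = 0].

Let good0 : good G0.
Proof.
split=> [p q [a ->] [b ->]|w [a [fa ->]]].
  by exists (a - b); rewrite !raddfB.
by rewrite (f_inj (esym (etrans (raddf0 f) fa))) raddf0.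
Qed.

Let maximal_good : exists H, [/\ good H, (G0 `<=` H)%classic &
  forall K, good K -> (H `<=` K)%classic -> (K `<=` H)%classic].
Proof.
have [F FP chF|S [Sg Smax]] :=
    @Zorn_bigcup _ (fun S => good (S `|` G0)%classic).
  have mem2 p q : (\bigcup_(X in F) X `|` G0)%classic p ->
      (\bigcup_(X in F) X `|` G0)%classic q ->
      exists2 X, (F X \/ X = set0) & (X `|` G0)%classic p /\
        (X `|` G0)%classic q.
    move=> [[X FX Xp]|Gp] [[Y FY Yq]|Gq].
    - case: (chF X Y FX FY) => [XY|YX].
        by exists Y; [left | split; left => //; apply: XY].
      by exists X; [left | split; left => //; apply: YX].
    - by exists X; [left | split; [left|right]].
    - by exists Y; [left | split; [right|left]].
    - by exists set0; [right | split; right].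
  have gX X : F X \/ X = set0 -> good (X `|` G0)%classic.
    by case=> [/FP//|->]; rewrite set0U.
  have sub X : F X \/ X = set0 ->
      ((X `|` G0) `<=` (\bigcup_(X in F) X `|` G0))%classic.
    move=> FX p [Xp|]; last by right.
    by case: FX => [FX|X0]; [left; exists X | move: Xp; rewrite X0].
  split=> [p q /mem2 h /h[X FX [Xp Xq]]|w Sw].
    by apply: (sub X FX); apply: (gX X FX).1.
  by have [X FX [Xw _]] := mem2 _ _ Sw Sw; apply: (gX X FX).2.
exists (S `|` G0)%classic; split=> [//|p Gp|K Kg SK p Kp]; first by right.
apply: contrapT => nSp; apply: (Smax K).
  split; last by move=> KS; apply: nSp; left; apply: KS.
  by move=> q Sq; apply: SK; left.
by rewrite (_ : (K `|` G0)%classic = K) //; apply/setUidPl => q Gq; apply: SK;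
  right.
Qed.

(** Baer's argument.  In a maximal partial homomorphism the values at the
    multiples of a new element [b] are governed by the least multiple [n b] of [b]
    in the domain, so that dividing the value at [n b] by [n] extends it to [b]. *)
Lemma divisible_extend : exists h : {additive B -> W}, forall a, h (f a) = g a.
Proof.
have [H [[Hsub Hfun] GH Hmax]] := maximal_good.
have H0 : H (0, 0) by apply: GH; exists 0; rewrite !raddf0.
have HN p : H p -> H (- p) by move=> Hp; rewrite -sub0r; apply: Hsub.
have HNp x w : H (x, w) -> H (- x, - w) by exact: HN.
have HD p q : H p -> H q -> H (p + q).
  by move=> Hp Hq; rewrite -[q]opprK; apply: Hsub => //; apply: HN.
have HMn p n : H p -> H (p *+ n).
  by move=> Hp; elim: n => [|n IH]; [rewrite mulr0n | rewrite mulrS; apply: HD].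
have HM p (k : int) : H p -> H (p *~ k).
  by move=> Hp; case: k => n; [apply: HMn | rewrite NegzE mulrNz; apply/HN/HMn].
have pairM (x : B) (w : W) (k : int) : (x, w) *~ k = (x *~ k, w *~ k).
  have nat_case n : (x, w) *+ n = (x *+ n, w *+ n).
    by elim: n => [|n IH]; rewrite ?mulr0n // !mulrS IH.
  by case: k => n; rewrite ?NegzE ?mulrNz -!pmulrn nat_case.
(* A value for [b] that is consistent with all multiples of [b] in the domain. *)
have ext b : exists c, forall (k : int) w, H (b *~ k, w) -> w = c *~ k.
  have [[n0 [n0_gt0 [w0 Hn0]]]|none] :=
      pselect (exists n, (0 < n)%N /\ exists w, H (b *+ n, w)); last first.
    exists 0 => k w Hk; rewrite mul0rz.
    have [k0|k_neq0] := eqVneq k 0; first by apply: Hfun;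
      rewrite k0 mulr0z in Hk.
    case: none; exists `|k|%N; rewrite absz_gt0; split=> //.
    case: k Hk {k_neq0} => n Hk; first by exists w.
    by exists (- w); move: (HNp _ _ Hk); rewrite NegzE mulrNz opprK.
  have ex_n : exists n, (0 < n)%N && `[< exists w, H (b *+ n, w) >].
    by exists n0; rewrite n0_gt0; apply/asboolP; exists w0.
  have [n /andP[n_gt0 /asboolP[v Hv]] n_min] := ex_minnP ex_n.
  have [c cv] := W_div v n_gt0.
  exists c => k w Hk.
  have [q [r [kE r_ge0 r_lt]]] :
      exists q r, [/\ k = n%:Z * q + r, 0 <= r & r < n%:Z].
    exists (k %/ n)%Z, (k %% n)%Z; split; [by rewrite mulrC; apply: divz_eq| |].
      by apply: modz_ge0; rewrite -lt0n.
    by apply: ltz_pmod.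
  have Hr : H (b *~ r, w - v *~ q).
    have := Hsub _ _ Hk (HM _ q Hv); rewrite pairM.
    suff -> : b *~ r = b *~ k - b *+ n *~ q by [].
    by rewrite kE mulrzDr mulrzA addrAC subrr add0r.
  have r0 : r = 0.
    case: r r_ge0 r_lt Hr {kE} => // -[//|m] _ m_lt Hm.
    have : (n <= m.+1)%N.
      by apply: n_min; apply/andP; split=> //; apply/asboolP; eexists;
        exact: Hm.
    by rewrite leqNgt -ltz_nat m_lt.
  rewrite r0 mulr0z in Hr; rewrite -[LHS](subrK (v *~ q)) (Hfun _ Hr) add0r.
  by rewrite kE r0 addr0 mulrzA -cv.
have tot b : exists w, H (b, w).
  have [c cP] := ext b.
  pose K := [set p : B * W | exists q k, H q /\ p = q + (b, c) *~ k]%classic.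
  suff /Hmax KH : good K.
    exists c; apply: KH; first by move=> p Hp; exists p, 0;
      rewrite mulr0z addr0.
    by exists 0, 1; rewrite add0r; split.
  split=> [p q [p1 [k [Hp ->]]] [q1 [l [Hq ->]]]|w [[x v] [k [Hx]]]].
    by exists (p1 - q1), (k - l); split;
      [apply: Hsub | rewrite mulrzBr opprD addrACA].
  rewrite pairM => -[x0 ->]; apply/eqP; rewrite addr_eq0; apply/eqP/esym.
  apply: (canLR (@opprK _)); apply/esym/cP.
  have -> : b *~ k = - x by apply/eqP; rewrite -addr_eq0 addrC -x0.
  exact: (HN _ Hx).
have [h hP] := choice tot.
have huniq b w : H (b, w) -> w = h b.
  move=> Hw; apply/eqP; rewrite -subr_eq0; apply/eqP/Hfun.
  have : H (b - b, w - h b) by apply: (Hsub (b, w) (b, h b)).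
  by rewrite subrr.
have hB : zmod_morphism h.
  by move=> x y; apply/esym/huniq; apply: (Hsub (x, h x) (y, h y)).
exists (mk_additive hB) => a; apply/esym/huniq/GH; by exists a.
Qed.

End DivisibleInjective.

Definition ctbl (T : Type) : Prop := exists f : nat -> T, forall x, exists n,
  f n = x.

Definition torsionless (A : zmodType) : Prop :=
  forall a : A, a != 0 -> exists psi : {additive A -> int}, psi a != 0.

Lemma torsionless_sub (A B : zmodType) (f : {additive A -> B}) :
  injective f -> torsionless B -> torsionless A.
Proof.
move=> f_inj tB a a0; have [|psi psia] := tB (f a).
  by rewrite -(raddf0 f) (inj_eq f_inj).
by exists (psi \o f : {additive _ -> _}).
Qed.

Lemma torsionless_torsion_free (A : zmodType) : torsionless A ->
    Z_torsion_free A.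
Proof.
move=> tA n x nx; have [->|x0] := eqVneq x 0; first by right.
have [psi psix] := tA x x0; left; apply/eqP.
have /eqP : psi (x *+ n) = 0 by rewrite nx raddf0.
by rewrite raddfMn /= -mulr_natr mulf_eq0 (negbTE psix) pnatr_eq0.
Qed.

Section CountableTorsionless.
Variable A : zmodType.

Let kills (B : set A) (psi : {additive A -> int}) := forall b, B b -> psi b = 0.

(* [A / B] is torsionless. *)
Let separated (B : set A) : Prop :=
  [/\ B 0, (forall x y, B x -> B y -> B (x - y)) &
      forall a, ~ B a -> exists2 psi, kills B psi & psi a != 0].

Let step (B : set A) (a : A) (B' : set A) (b : A) : Prop :=
  [/\ separated B', (B `<=` B')%classic, B' a /\ B' b,
      (forall c, B' c -> exists k : int, B (c - b *~ k)) &
      b = 0 \/ exists2 psi, kills B psi & psi b != 0].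

Let step_exists B a : separated B -> exists B' b, step B a B' b.
Proof.
move=> sepB; have [B0 Bsub Bsep] := sepB; have [Ba|nBa] := pselect (B a).
  by exists B, 0; split=> //; [move=> c Bc; exists 0;
    rewrite mulr0z subr0 | left].
have [psi Bpsi psia] := Bsep a nBa.
pose B' : set A := fun c => forall phi, kills B phi -> phi a = 0 -> phi c = 0.
(* Otherwise some [phi] detects [c], and [psi a * phi - phi a * psi] kills [B]
   and [a] but not [c]. *)
have psi_inj c : B' c -> psi c = 0 -> B c.
  move=> B'c psic; apply: contrapT => /Bsep[phi Bphi phic].
  have cmbB : zmod_morphism (fun x => psi a * phi x - phi a * psi x).
    by move=> x y; rewrite !raddfB !mulrBr !opprD !opprK addrACA.
  have : mk_additive cmbB c = 0.
    apply: B'c => [b Bb|]; first by rewrite mk_additiveE (Bphi b) // (Bpsi b) //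
      !mulr0 subr0.
    by rewrite mk_additiveE mulrC subrr.
  rewrite mk_additiveE => /eqP; rewrite psic mulr0 subr0 mulf_eq0 (negbTE psia)
    /=.
  by rewrite (negbTE phic).
have B'a : B' a by move=> phi _.
have ex_n : exists n, (0 < n)%N && `[< exists2 c, B' c & `|psi c|%N = n >].
  by exists `|psi a|%N; rewrite absz_gt0 psia; apply/asboolP; exists a.
have [n /andP[n_gt0 /asboolP[b B'b psib]] n_min] := ex_minnP ex_n.
have psib0 : psi b != 0 by rewrite -absz_gt0 psib.
have B'sub x y : B' x -> B' y -> B' (x - y).
  by move=> B'x B'y phi Bphi phia; rewrite raddfB B'x // B'y // subr0.
have B'M x (k : int) : B' x -> B' (x *~ k).
  by move=> B'x phi Bphi phia; rewrite raddfMz B'x // mul0rz.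
exists B', b; split=> //; last by right; exists psi.
- split=> // [phi|c nB'c]; first by rewrite raddf0.
  apply: contrapT => nphi; apply: nB'c => phi Bphi phia; apply/eqP.
  apply: contrapT => /negP phic; apply: nphi; exists phi => // x B'x.
  exact: B'x.
- by move=> x Bx phi Bphi _; apply: Bphi.
move=> c B'c; exists (psi c %/ psi b)%Z; apply: psi_inj.
  by apply: B'sub => //; apply: B'M.
have -> : psi (c - b *~ (psi c %/ psi b)%Z) = (psi c %% psi b)%Z.
  by rewrite raddfB raddfMz /= -mulrzr intz /modz mulrC.
apply/eqP; rewrite -absz_eq0 -leqn0 leqNgt; apply/negP => r_gt0.
have : (n <= `|(psi c %% psi b)%Z|)%N.
  apply: n_min; rewrite r_gt0; apply/asboolP.
  exists (c - b *~ (psi c %/ psi b)%Z); first by apply: B'sub => //; apply: B'M.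
  by rewrite raddfB raddfMz /= -mulrzr intz /modz mulrC.
rewrite leqNgt -psib => /negP; apply.
by rewrite -ltz_nat gez0_abs ?modz_ge0 // ltz_mod.
Qed.

(** Enumerate [A] and adjoin its elements one at a time, keeping the quotient
    [A / B] torsionless.  To adjoin [a], take all elements on which every form
    killing [B] and [a] vanishes: a single form [psi] killing [B] with
    [psi a <> 0] embeds the new quotient [B' / B] in [Z], so it is cyclic. *)
Lemma countable_torsionless_free : ctbl A -> torsionless A -> Z_free A.
Proof.
move=> [a a_surj] tA.
have sep0 : separated (fun x => x = 0).
  by split=> // [x y -> ->|x /eqP /tA[psi psix]]; [rewrite subr0 |
     exists psi => // b ->; rewrite raddf0].
have /choice[F FP] : forall p : {B | separated B} * A,
    exists q : {B | separated B} * A, step (sval p.1) p.2 (sval q.1) q.2.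
  move=> [[B sB] x]; have [B' [b st]] := step_exists x sB.
  by have [sB' _ _ _ _] := st; exists (exist _ B' sB', b).
pose st : nat -> {B | separated B} :=
  fix st n := if n is m.+1 then (F (st m, a m)).1 else exist _ _ sep0.
pose B n := sval (st n); pose b n := (F (st n, a n)).2.
have stepP n : step (B n) (a n) (B n.+1) (b n) by apply: (FP (st n, a n)).
have Bmono m n : (m <= n)%N -> (B m `<=` B n)%classic.
  elim: n => [|n IH]; first by rewrite leqn0 => /eqP ->.
  rewrite leq_eqVlt => /orP[/eqP -> //|/IH Bmn x /Bmn].
  by have [_ h _ _ _] := stepP n; apply: h.
(* The steps with [b n = 0] are those at which [a n] was already present. *)
pose X : choiceType := {n : nat | b n != 0}.
pose f : {linear {malg int[X]} -> zmodule A} :=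
  lin_ext (fun x : X => b (val x) : zmodule A).
have f_surj y : exists u, f u = y.
  have [n <-] := a_surj y; have : B n.+1 (a n) by have [_ _ []] := stepP n.
  move: (a n) => c; elim: (n.+1) c => [|m IH] c Bc.
    by exists 0; rewrite raddf0 (Bc : c = 0).
  have [_ _ _ /(_ c Bc)[k /IH[u fu]] _] := stepP m.
  have [bm0|bm0] := eqVneq (b m) 0.
    by exists u; rewrite fu bm0 mul0rz subr0.
  exists (u + << k *g (exist _ m bm0 : X) >>).
  by rewrite raddfD /= fu lin_extU /= scalezrE subrK.
have f_inj : injective f.
  apply: raddf_inj => u fu0.
  have [N ltN] : exists N, forall x, x \in msupp u -> (val x < N)%N.
    exists (\max_(x <- msupp u) val x).+1 => x xu.
    by rewrite ltnS (big_fsetD1 x) //= leq_maxl.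
  elim: N ltN => [|N IH] ltN.
    apply/malgP => x; rewrite mcoeff0; apply/mcoeff_outdom/negP => /ltN.
    by [].
  apply: IH => x xu; rewrite ltn_neqAle -ltnS ltN // andbT; apply/eqP => xN.
  have [_ _ _ _ [b0|[psi psiB psib]]] := stepP N.
    by move: (valP x); rewrite xN b0 eqxx.
  have : psi (f u) = 0 by rewrite fu0 raddf0.
  rewrite /f /= /lin_ext raddf_sum (big_fsetD1 x) //= big1_fset; last first.
    move=> y; rewrite !inE => /andP[yx yu] _.
    rewrite scalezrE raddfMz /= psiB ?mul0rz //.
    have lt_yN : (val y < N)%N.
      by rewrite ltn_neqAle -ltnS ltN // andbT -xN (inj_eq val_inj).
    by apply: (Bmono _ _ lt_yN); have [_ _ []] := stepP (val y).
  rewrite addr0 scalezrE raddfMz /= xN -mulrzr intz => /eqP.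
  by rewrite mulf_eq0 (negbTE psib) /= mcoeff_eq0 xu.
exists X, f; have [g gP] := choice f_surj; exists g => [u|//].
by apply: f_inj; rewrite gP.
Qed.

End CountableTorsionless.

Lemma ctbl_surj (T U : Type) (f : T -> U) :
  (forall y, exists x, f x = y) -> ctbl T -> ctbl U.
Proof.
move=> f_surj [a a_surj]; exists (f \o a) => y.
by have [x <-] := f_surj y; have [n <-] := a_surj x; exists n.
Qed.

Lemma ctbl_countType (T : countType) (x0 : T) : ctbl T.
Proof.
exists (fun n => odflt x0 (choice.unpickle n)) => x.
by exists (choice.pickle x); rewrite choice.pickleK.
Qed.

Lemma ctbl_sub (T : choiceType) (P : pred T) (sT : subType P) (x0 : sT) :
  ctbl T -> ctbl sT.
Proof.
apply: (ctbl_surj (f := insubd x0)) => y.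
by exists (val y); rewrite valKd.
Qed.

Lemma ctbl_malg (K : choiceType) (R : zmodType) :
  ctbl K -> ctbl R -> ctbl {malg R[K]}.
Proof.
move=> [k k_surj] [r r_surj].
apply: (ctbl_surj (f := fun s : seq (nat * nat) =>
  \sum_(p <- s) << r p.1 *g k p.2 >>)); last exact: (ctbl_countType [::]).
move=> u; rewrite (monalgE u); elim: (enum_fset (msupp u)) => [|x s [t tE]].
  by exists [::]; rewrite !big_nil.
have [m mE] := r_surj u@_x; have [n nE] := k_surj x.
by exists ((m, n) :: t); rewrite !big_cons tE /= mE nE.
Qed.

Lemma torsionless_malg (K : choiceType) (A : zmodType) :
  torsionless A -> torsionless {malg A[K]}.
Proof.
move=> tA u u0.
have [k uk] : exists k, u@_k != 0.
  apply: contrapT => nk; move/negP: u0; apply; apply/eqP/malgP => k.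
  by rewrite mcoeff0; apply/eqP; apply: contrapT => /negP uk; apply: nk;
    exists k.
have [psi psiu] := tA _ uk.
by exists (psi \o mcoeff k : {additive _ -> _}).
Qed.

Lemma torsionless_int : torsionless int.
Proof. by move=> n n0; exists (idfun : {additive int -> int}). Qed.

(** * Modules and tensor products over an arbitrary ring *)

Section Exactness.
Variable R : nzRingType.
Implicit Types A B C F K M P U X : lmodType R.

Definition surj (T U : Type) (f : T -> U) : Prop := forall y, exists x, f x = y.

Definition ses A B C (i : {linear A -> B}) (p : {linear B -> C}) : Prop :=
  [/\ injective i, (forall b, p b = 0 <-> exists a, i a = b) & surj p].

Definition projective P : Prop :=
  forall A B (p : {linear A -> B}) (f : {linear P -> B}), surj p ->
  exists g : {linear P -> A}, forall x, p (g x) = f x.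

Lemma ses_ker_lift A B C X (i : {linear A -> B}) (p : {linear B -> C})
    (f : {linear X -> B}) : ses i p -> (forall x, p (f x) = 0) ->
  exists g : {linear X -> A}, forall x, i (g x) = f x.
Proof.
move=> [i_inj ex _] pf.
have /choice[g gP] : forall x, exists a, i a = f x by move=> x; apply/ex/pf.
have gL : linear g by move=> a x y; apply: i_inj; rewrite !linearP !gP linearP.
by exists (mk_linear gL).
Qed.

Lemma ses_coker_lift A B C X (i : {linear A -> B}) (p : {linear B -> C})
    (f : {linear B -> X}) : ses i p -> (forall a, f (i a) = 0) ->
  exists g : {linear C -> X}, forall b, g (p b) = f b.
Proof.
move=> [_ ex p_surj] fi; have [s sP] := choice p_surj.
have f_eq b b' : p b = p b' -> f b = f b'.
  move=> pbb'; have [|a aE] := (ex (b - b')).1;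
    first by rewrite linearB pbb' subrr.
  by apply/eqP; rewrite -subr_eq0 -linearB -aE fi.
have gL : linear (f \o s).
  by move=> a x y; rewrite /= -linearP; apply: f_eq; rewrite linearP !sP.
by exists (mk_linear gL) => b; apply: f_eq; rewrite sP.
Qed.

Lemma lin_ext_unique (T : choiceType) M (f g : {linear {malg R[T]} -> M}) :
  (forall x, f << x >> = g << x >>) -> forall c, f c = g c.
Proof.
move=> fg c; rewrite (monalgE c) !raddf_sum; apply/eq_bigr => x _ /=.
have -> : << c@_x *g x >> = c@_x *: (<< x >> : {malg R[T]}).
  by apply/malgP => k; rewrite mcoeffZ !mcoeffU mulrnAr mulr1.
by rewrite !linearZ /= fg.
Qed.

Lemma malg_projective (X : choiceType) : projective {malg R[X]}.
Proof.
move=> A B p f p_surj; have [s sP] := choice p_surj.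
exists (lin_ext (fun x => s (f << x >>))) => c.
pose h : {linear {malg R[X]} -> B} := p \o lin_ext (fun x => s (f << x >>)).
apply: (lin_ext_unique (f := h)) => x.
by rewrite /h /= lin_extU scale1r sP.
Qed.

Fact sincl_key M : {f : {linear syzygy1 M -> {malg R[M]}} | forall z,
    f z = val z}.
Proof.
by exists (@mk_linear R (syzygy1 M) {malg R[M]} (fun z => val z)
  (fun a z w => erefl)).
Qed.

(** The inclusion of the first syzygy; kept opaque so that simplification does
    not expose the underlying subtype. *)
Definition sincl M : {linear syzygy1 M -> {malg R[M]}} := sval (sincl_key M).

Lemma sinclE M (z : syzygy1 M) : sincl M z = val z.
Proof. exact: (svalP (sincl_key M)). Qed.

Lemma sincl_inj M : injective (sincl M).
Proof. by move=> z w; rewrite !sinclE => /val_inj. Qed.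

Lemma coverU M m : cover (<< m >> : {malg R[M]}) = m.
Proof. by rewrite /cover lin_extU scale1r. Qed.

Lemma ses_syzygy M : ses (sincl M) (@cover R M : {linear _ -> _}).
Proof.
split=> [||m]; [exact: sincl_inj| |exact: cover_surj].
move=> c; split=> [/eqP c0|[z <-]]; last by rewrite sinclE; exact/eqP/(valP z).
by exists (exist _ c c0); rewrite sinclE.
Qed.

Lemma cover_sincl M z : cover (sincl M z) = 0.
Proof. by have [_ ex _] := ses_syzygy M; apply/ex; exists z. Qed.

Lemma cover_ker M (c : {malg R[M]}) : cover c = 0 -> exists z, sincl M z = c.
Proof. by have [_ ex _] := ses_syzygy M; move/ex. Qed.

(** In the category of modules modulo projectives, [M] is a retract of [M']. *)
Definition stable_retract M M' : Prop :=
  exists P, projective P /\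
  exists (s : {linear M -> M'}) (r : {linear M' -> M})
         (u : {linear M -> P}) (v : {linear P -> M}),
  forall m, m = r (s m) + v (u m).

(** Vanishing of [Ext^1(-, F)] or [Tor_1(I, -)] is a property of this kind, and
    so are its shifts to higher degrees; this is what makes them independent of
    the presentation used to compute them. *)
Definition stable (phi : lmodType R -> Prop) : Prop :=
  forall M M', stable_retract M M' -> phi M' -> phi M.

Lemma stable_retract_lift M M' : stable_retract M M' ->
  exists (sP : {linear {malg R[M]} -> {malg R[M']}})
         (sO : {linear syzygy1 M -> syzygy1 M'})
         (rO : {linear syzygy1 M' -> syzygy1 M})
         (w : {linear {malg R[M]} -> syzygy1 M}),
  (forall z, sincl M' (sO z) = sP (sincl M z)) /\
  (forall z, z = rO (sO z) + w (sincl M z)).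
Proof.
move=> [P [Pproj [s [r [u [v E]]]]]].
have cov_surj (N : lmodType R) : surj (@cover R N) := @cover_surj R N.
have lift (N N' : lmodType R) (f : {linear N -> N'}) : exists g
  : {linear {malg R[N]} -> {malg R[N']}},
    forall c, cover (g c) = f (cover c).
  by apply: (malg_projective (p := @cover R N' : {linear _ -> _})
    (f \o @cover R N : {linear _ -> _})) (@cov_surj N').
have liftO (N N' : lmodType R) (g : {linear {malg R[N]} -> {malg R[N']}})
  (f : {linear N -> N'}) :
    (forall c, cover (g c) = f (cover c)) ->
    exists h : {linear syzygy1 N -> syzygy1 N'},
      forall z, sincl N' (h z) = g (sincl N z).
  move=> gf; apply: (ses_ker_lift (f := g \o sincl N : {linear _ -> _})
    (ses_syzygy N')).
  by move=> z; rewrite /= gf cover_sincl linear0.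
have [sP sPE] := lift _ _ s; have [rP rPE] := lift _ _ r.
have [sO sOE] := liftO _ _ _ _ sPE; have [rO rOE] := liftO _ _ _ _ rPE.
have [vP vPE] := Pproj _ _ (@cover R M : {linear _ -> _}) v (@cov_surj M).
(* On the free cover, the identity and its factorization differ by a map into the
   syzygy. *)
pose d : {linear {malg R[M]} -> {malg R[M]}} :=
  idfun \- (rP \o sP) \- (vP \o (u \o @cover R M)).
have [w wE] : exists w : {linear {malg R[M]} -> syzygy1 M},
    forall c, sincl M (w c) = d c.
  apply: ses_ker_lift (ses_syzygy M) _ => c.
  rewrite /d /= !linearB /= rPE sPE vPE; apply/eqP.
  by rewrite -addrA -opprD -E subrr.
exists sP, sO, rO, w; split=> // z.
apply: sincl_inj.
rewrite linearD rOE sOE wE /d /= cover_sincl (linear0 u) (linear0 vP) subr0.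
by rewrite addrC subrK.
Qed.

Lemma stable_retract_syzygy M M' :
  stable_retract M M' -> stable_retract (syzygy1 M) (syzygy1 M').
Proof.
move=> /stable_retract_lift[sP [sO [rO [w [_ E]]]]].
exists {malg R[M]}; split; first exact: malg_projective.
by exists sO, rO, (sincl M), w.
Qed.

Lemma schanuel K P M (i : {linear K -> P}) (p : {linear P -> M}) :
  ses i p -> projective P ->
  stable_retract K (syzygy1 M) /\ stable_retract (syzygy1 M) K.
Proof.
move=> ip Pproj; have [i_inj ip_ex p_surj] := ip.
have cov_surj : surj (@cover R M) := @cover_surj R M.
have [a aE] := Pproj _ _ (@cover R M : {linear _ -> _}) p cov_surj.
have [b bE] := malg_projective (@cover R M : {linear _ -> _}) p_surj.
have [s sE] : exists s : {linear K -> syzygy1 M}, forall k,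
  sincl M (s k) = a (i k).
  apply: (ses_ker_lift (f := a \o i : {linear _ -> _}) (ses_syzygy M)) => k.
  by rewrite /= aE; apply/ip_ex; exists k.
have [r rE] : exists r : {linear syzygy1 M -> K}, forall z,
  i (r z) = b (sincl M z).
  apply: (ses_ker_lift (f := b \o sincl M : {linear _ -> _}) ip) => z.
  by rewrite /= bE /= cover_sincl.
have [w wE] : exists w : {linear P -> K}, forall x, i (w x) = x - b (a x).
  apply: (ses_ker_lift (f := idfun \- (b \o a) : {linear _ -> _}) ip) => x.
  by rewrite /= linearB /= bE aE subrr.
have [w' w'E] : exists w : {linear {malg R[M]} -> syzygy1 M},
    forall x, sincl M (w x) = x - a (b x).
  apply: (ses_ker_lift (f := idfun \- (a \o b) : {linear _ -> _})
    (ses_syzygy M)) => x.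
  by rewrite /= linearB /= aE bE subrr.
split.
  exists P; split=> //; exists s, r, i, w => k; apply: i_inj.
  by rewrite linearD /= rE sE wE addrC subrK.
exists {malg R[M]}; split; first exact: malg_projective.
exists r, s, (sincl M), w' => z; apply: sincl_inj.
by rewrite linearD /= sE rE w'E addrC subrK.
Qed.

Lemma stable_syzygy phi n : stable phi -> stable (fun M => phi (syzygy M n)).
Proof.
move=> st M M' MM'; apply: st; elim: n => //= n; exact: stable_retract_syzygy.
Qed.

(** Dimension shifting.  The canonical syzygy may be replaced by the kernel of any
    projective presentation, by Schanuel's lemma. *)
Lemma stable_shift phi n K P M (i : {linear K -> P}) (p : {linear P -> M}) :
  stable phi -> ses i p -> projective P ->
  phi (syzygy M n.+1) <-> phi (syzygy K n).
Proof.
move=> /(stable_syzygy (n := n)) st ip /(schanuel ip)[KM MK].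
by rewrite /syzygy iterSr; split; apply: st.
Qed.

Definition Ext1_zero M F : Prop :=
  forall h : {linear syzygy1 M -> F},
  exists e : {linear {malg R[M]} -> F}, forall z, e (sincl M z) = h z.

Lemma Ext1_zero_stable F : stable (fun M => Ext1_zero M F).
Proof.
move=> M M' /stable_retract_lift[sP [sO [rO [w [sE E]]]]] extM' h.
have [e eE] := extM' (h \o rO : {linear _ -> _}).
exists ((e \o sP) \+ (h \o w)) => z /=.
by rewrite -sE eE /= -linearD -E.
Qed.

(** Every short exact sequence ending in [C] is a pushout of the canonical
    presentation of [C], so extending maps along the latter suffices. *)
Lemma Ext1_zero_extend A B C F (i : {linear A -> B}) (p : {linear B -> C}) :
  ses i p -> Ext1_zero C F -> forall h : {linear A -> F},
  exists e : {linear B -> F}, forall a, e (i a) = h a.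
Proof.
move=> ip extC h; have [i_inj ip_ex p_surj] := ip.
have [b bE] := malg_projective (@cover R C : {linear _ -> _}) p_surj.
have [r rE] : exists r : {linear syzygy1 C -> A}, forall z,
  i (r z) = b (sincl C z).
  apply: (ses_ker_lift (f := b \o sincl C : {linear _ -> _}) ip) => z.
  by rewrite /= bE /= cover_sincl.
have [e eE] := extC (h \o r : {linear _ -> _}).
have /choice[ac acE] : forall x, exists ac : A * {malg R[C]},
    x = i ac.1 + b ac.2 /\ p x = cover ac.2.
  move=> x; have [|a aE] := (ip_ex (x - b (<< p x >> : {malg R[C]}))).1.
    by rewrite linearB bE /= coverU subrr.
  by exists (a, << p x >>); rewrite /= aE subrK coverU.
pose a x := (ac x).1; pose c x := (ac x).2.
have aE x : x = i (a x) + b (c x) := (acE x).1.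
have cE x : p x = cover (c x) := (acE x).2.
have fE x y d : x = i y + b d -> h (a x) + e (c x) = h y + e d.
  move=> xE; have [z zE] : exists z, sincl C z = c x - d.
    apply: cover_ker; rewrite linearB /= -cE xE linearD bE.
    rewrite (_ : p (i y) = 0) ?add0r ?subrr //.
    by apply/ip_ex; exists y.
  have ay : y - a x = r z.
    apply: i_inj; rewrite rE zE (linearB i) (linearB b); apply/eqP.
    by rewrite subr_eq addrAC eq_sym subr_eq [_ + i (a x)]addrC -aE xE.
  have /eqP : h y - h (a x) = e (c x) - e d.
    by rewrite -(linearB h) ay -(linearB e) -zE eE.
  by rewrite subr_eq => /eqP ->; rewrite addrAC subrK addrC.
have fL : linear (fun x => h (a x) + e (c x)).
  move=> k x y /=; rewrite (fE _ (k *: a x + a y) (k *: c x + c y)).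
    by rewrite !linearP scalerDr addrACA.
  by rewrite !linearP addrACA -scalerDr -!aE.
exists (mk_linear fL) => y; rewrite mk_linearE (fE _ y 0) ?linear0 ?addr0 //.
Qed.

(** The obstruction to lifting [f] along [p] lies in [Ext^1 (U, B1)]. *)
Lemma Ext1_zero_lift B1 B2 B3 U (i : {linear B1 -> B2}) (p : {linear B2 -> B3})
    :
  ses i p -> Ext1_zero U B1 -> forall f : {linear U -> B3},
  exists g : {linear U -> B2}, forall u, p (g u) = f u.
Proof.
move=> ip ext f; have [i_inj ip_ex p_surj] := ip.
have [g gE] := malg_projective (f \o @cover R U : {linear _ -> _}) p_surj.
have [h hE] : exists h : {linear syzygy1 U -> B1}, forall z,
  i (h z) = g (sincl U z).
  apply: (ses_ker_lift (f := g \o sincl U : {linear _ -> _}) ip) => z.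
  by rewrite /= gE /= cover_sincl linear0.
have [e eE] := ext h.
have [k kE] : exists k : {linear U -> B2}, forall c,
  k (cover c) = g c - i (e c).
  apply: (ses_coker_lift (f := g \- (i \o e) : {linear _ -> _}) (ses_syzygy U))
    => z.
  by rewrite /= eE hE subrr.
exists k => u; rewrite -[u]coverU kE linearB /= gE /=.
by rewrite (_ : p (i _) = 0) ?subr0 //; apply/ip_ex; eexists.
Qed.

(** Exactness of [Ext^1 (U, B2) -> Ext^1 (U, B3) -> Ext^2 (U, B1)]. *)
Lemma Ext1_zero_quotient B1 B2 B3 U (i : {linear B1 -> B2})
    (p : {linear B2 -> B3}) :
  ses i p -> Ext1_zero U B2 -> Ext1_zero (syzygy1 U) B1 -> Ext1_zero U B3.
Proof.
move=> ip ext2 ext1 h; have [g gE] := Ext1_zero_lift ip ext1 h.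
by have [e eE] := ext2 g; exists (p \o e) => z /=; rewrite eE gE.
Qed.

(** Exactness of [Ext^1 (U, B3) -> Ext^2 (U, B1) -> Ext^2 (U, B2)]. *)
Lemma Ext1_zero_syzygy B1 B2 B3 U (i : {linear B1 -> B2})
    (p : {linear B2 -> B3}) :
  ses i p -> Ext1_zero (syzygy1 U) B2 -> Ext1_zero U B3 ->
    Ext1_zero (syzygy1 U) B1.
Proof.
move=> ip ext2 ext3 h; have [i_inj ip_ex p_surj] := ip.
have [e eE] := ext2 (i \o h : {linear _ -> _}).
have [f fE] : exists f : {linear syzygy1 U -> B3}, forall c,
  f (cover c) = p (e c).
  apply: (ses_coker_lift (f := p \o e : {linear _ -> _}) (ses_syzygy _)) => z.
  by rewrite /= eE; apply/ip_ex; eexists.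
have [f' f'E] := ext3 f; have [g gE] := malg_projective f' p_surj.
have [d dE] : exists d : {linear {malg R[syzygy1 U]} -> B1},
    forall c, i (d c) = e c - g (sincl U (cover c)).
  apply: (ses_ker_lift (f := e \- (g \o (sincl U \o @cover R _))
    : {linear _ -> _}) ip).
  by move=> c; rewrite /= linearB /= gE f'E fE subrr.
by exists d => z; apply: i_inj;
  rewrite dE cover_sincl (linear0 (sincl U)) (linear0 g) subr0 eE.
Qed.

Lemma Ext1_zero_retract U B B' (s : {linear B -> B'}) (r : {linear B' -> B}) :
  (forall b, r (s b) = b) -> Ext1_zero U B' -> Ext1_zero U B.
Proof.
move=> rs ext h; have [e eE] := ext (s \o h : {linear _ -> _}).
by exists (r \o e) => z; rewrite /= eE /= rs.
Qed.

End Exactness.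

Section TensorLift.
Variables (R : nzRingType) (I : lmodType R^c) (M : lmodType R) (V : zmodType).
Variable b : I -> M -> V.
Hypotheses (bDl : forall x x' m, b (x + x') m = b x m + b x' m)
  (bDr : forall x m m', b x (m + m') = b x m + b x m')
  (bZ : forall x (r : R) m, b ((r : R^c) *: x) m = b x (r *: m)).

Let pre : {malg int[(I * M)%type]} -> zmodule V :=
  lin_ext (fun p => b p.1 p.2 : zmodule V).

Let preU p : pre << p >> = b p.1 p.2.
Proof. by rewrite /pre lin_extU scale1r. Qed.

HB.instance Definition _ := GRing.Linear.on pre.

Let pre_rel s : tensor_rel s -> pre s = 0.
Proof.
case=> [x x' m|x m m'|x r m]; rewrite !raddfB /= !preU /=.
- by rewrite bDl addrAC addrK subrr.
- by rewrite bDr addrAC addrK subrr.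
- by rewrite bZ subrr.
Qed.

Lemma tensor_lift :
  exists h : {additive tensor I M -> V}, forall x m, h (tens x m) = b x m.
Proof.
pose h (t : tensor I M) : V := pre (repr t).
have h_pi u : h (\pi_(tensor I M)%qT u) = pre u.
  apply/eqP; rewrite -subr_eq0 -(raddfB pre); apply/eqP.
  by apply: (zspanp_kernel pre_rel); rewrite Quotient.idealrBE reprK.
have hB : zmod_morphism h.
  move=> t u; rewrite -[t]reprK -[u]reprK -(raddfB \pi_(tensor I M)%qT).
  by rewrite !h_pi raddfB.
by exists (mk_additive hB) => x m; rewrite mk_additiveE h_pi preU.
Qed.

End TensorLift.

Section Tensor.
Variables (R : nzRingType) (I : lmodType R^c).
Implicit Types A B C M N P : lmodType R.

Lemma tens0l M (m : M) : tens (0 : I) m = 0.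
Proof.
by apply/(@addrI _ (tens (0 : I) m)); rewrite -tensDl !addr0.
Qed.

Lemma tens0r M (x : I) : tens x (0 : M) = 0.
Proof.
by apply/(@addrI _ (tens x (0 : M))); rewrite -tensDr !addr0.
Qed.

Lemma tens_sumr M (T : Type) (s : seq T) (F : T -> M) (x : I) :
  tens x (\sum_(i <- s) F i) = \sum_(i <- s) tens x (F i).
Proof. exact: (big_morph _ (tensDr x) (tens0r M x)). Qed.

Lemma tensNl M (x : I) (m : M) : tens (- x) m = - tens x m.
Proof. by apply/eqP; rewrite -addr_eq0 -tensDl addNr tens0l. Qed.

Lemma tensMzl M (x : I) (m : M) (k : int) : tens (x *~ k) m = tens x m *~ k.
Proof.
have nat_case n : tens (x *+ n) m = tens x m *+ n.
  by elim: n => [|n IH]; rewrite ?mulr0n ?tens0l // !mulrS tensDl IH.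
by case: k => n; rewrite ?NegzE ?mulrNz ?tensNl -!pmulrn nat_case.
Qed.

Lemma tensorP M (t : tensor I M) : exists s : seq (I * M),
    t = \sum_(p <- s) tens p.1 p.2.
Proof.
have piE (a : int) p : \pi_(tensor I M)%qT << a *g p >> = tens (p.1 *~ a) p.2.
  rewrite tensMzl /tens -(raddfMz \pi_(tensor I M)%qT) -surjective_pairing.
  by rewrite -(raddfMz (mkmalgU p)) /= intz.
rewrite -[t]reprK; move: (repr t) => u; rewrite (monalgE u) raddf_sum.
elim: (enum_fset (msupp u)) => [|p s [s' IH]]; first by exists [::];
  rewrite !big_nil.
by exists ((p.1 *~ u@_p, p.2) :: s'); rewrite !big_cons IH /= -piE.
Qed.

Lemma tensor_ext M (V : zmodType) (f g : {additive tensor I M -> V}) :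
  (forall x m, f (tens x m) = g (tens x m)) -> forall t, f t = g t.
Proof.
move=> fg t; have [s ->] := tensorP t; rewrite !raddf_sum.
by apply/eq_bigr => p _ /=.
Qed.

Lemma tensor_map_comp M N P (f : {linear M -> N}) (g : {linear N -> P})
    (h : {linear M -> P}) : (forall m, g (f m) = h m) ->
  forall t : tensor I M, tensor_map g (tensor_map f t) = tensor_map h t.
Proof.
move=> gf; apply: (tensor_ext (f :=
  tensor_map g \o tensor_map f : {additive _ -> _})).
by move=> x m; rewrite /= !tensor_mapE gf.
Qed.

Lemma tensor_map_id M (f : {linear M -> M}) : (forall m, f m = m) ->
  forall t : tensor I M, tensor_map f t = t.
Proof.
move=> f1; apply: (tensor_ext (g := idfun : {additive _ -> _})) => x m.
by rewrite /= tensor_mapE f1.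
Qed.

Lemma tensor_mapD M N (f g h : {linear M -> N}) : (forall m, h m = f m + g m) ->
  forall t : tensor I M, tensor_map h t = tensor_map f t + tensor_map g t.
Proof.
move=> hE; apply: (tensor_ext (g :=
  tensor_map f \+ tensor_map g : {additive _ -> _})).
by move=> x m; rewrite /= !tensor_mapE hE tensDr.
Qed.

Lemma tensor_map_surj M N (f : {linear M -> N}) :
  surj f -> surj (@tensor_map R I M N f).
Proof.
move=> f_surj t; have [s ->] := tensorP t; have [g gE] := choice f_surj.
exists (\sum_(p <- s) tens p.1 (g p.2)); rewrite raddf_sum.
by apply/eq_bigr => p _ /=; rewrite tensor_mapE gE.
Qed.

Lemma tensor_contract_exists M (phi : {linear M -> R^o}) :
  exists h : {additive tensor I M -> I},
    forall x m, h (tens x m) = (phi m : R^c) *: x.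
Proof.
apply: (tensor_lift (b := fun x m => (phi m : R^c) *: x)).
- by move=> x x' m; rewrite scalerDr.
- by move=> x m m'; rewrite linearD scalerDl.
- by move=> x r m; rewrite linearZ scalerA.
Qed.

Definition contract M (phi : {linear M -> R^o}) : {additive tensor I M -> I} :=
  projT1 (cid (tensor_contract_exists phi)).

Lemma contractE M (phi : {linear M -> R^o}) x m :
  contract phi (tens x m) = (phi m : R^c) *: x.
Proof. by rewrite /contract; case: cid. Qed.

Lemma contract_map M N (f : {linear M -> N}) (phi : {linear N -> R^o})
    (psi : {linear M -> R^o}) : (forall m, phi (f m) = psi m) ->
  forall t, contract phi (tensor_map f t) = contract psi t.
Proof.
move=> E; apply: (tensor_ext (f :=
  contract phi \o tensor_map f : {additive _ -> _})).
by move=> x m; rewrite /= tensor_mapE !contractE E.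
Qed.

Lemma tensor_map_sum M N (f : {linear M -> N}) (T : eqType) (s : seq T)
    (x : T -> I) (m : T -> M) :
  tensor_map f (\sum_(p <- s) tens (x p) (m p)) = \sum_(p <- s) tens (x p)
    (f (m p)).
Proof.
rewrite (big_morph (tensor_map f) (raddfD (tensor_map f))
  (raddf0 (tensor_map f))).
by apply/eq_bigr => p _; rewrite tensor_mapE.
Qed.

Lemma contract_sum M (phi : {linear M -> R^o}) (T : eqType) (s : seq T)
    (x : T -> I) (m : T -> M) :
  contract phi (\sum_(p <- s) tens (x p) (m p)) =
  \sum_(p <- s) (phi (m p) : R^c) *: x p.
Proof. by rewrite raddf_sum; apply/eq_bigr => p _; rewrite /= contractE. Qed.

Definition mcoeff_lin (X : choiceType) (k : X) : {linear {malg R[X]} -> R^o} :=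
  @mk_linear R {malg R[X]} R^o (mcoeff k)
    (fun a x y => etrans (mcoeffD k _ _) (congr1 (+%R^~ _) (mcoeffZ a x k))).

Lemma mcoeff_linE (X : choiceType) (k : X) c : mcoeff_lin k c = c@_k.
Proof. by []. Qed.

(** [I (x) R^(X)] is the direct sum of copies of [I] indexed by [X]. *)
Lemma tensor_free_eq0 (X : choiceType) (t : tensor I {malg R[X]}) :
  (forall k, contract (mcoeff_lin k) t = 0) -> t = 0.
Proof.
suff [d dP] : exists d0 : {fset X}, forall d, d0 `<=` d ->
    t = \sum_(k <- d) tens (contract (mcoeff_lin k) t) << k >>.
  move=> t0; rewrite (dP d (fsubset_refl d)) big1 // => k _.
  by rewrite t0 tens0l.
have [s ->] := tensorP t; elim: s => [|p s [d0 IH]].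
  exists fset0 => d _; rewrite big_nil big1 // => k _.
  by rewrite raddf0 tens0l.
exists (msupp p.2 `|` d0) => d le_d; rewrite big_cons.
rewrite [in LHS](IH d (fsubset_trans (fsubsetUr _ _) le_d)).
have -> : \sum_(k <- d) tens (contract (mcoeff_lin k)
      (tens p.1 p.2 + \sum_(q <- s) tens q.1 q.2)) (<< k >> : {malg R[X]}) =
    \sum_(k <- d) tens (contract (mcoeff_lin k) (tens p.1 p.2)) << k >> +
    \sum_(k <- d) tens (contract (mcoeff_lin k) (\sum_(q <- s) tens q.1 q.2)) <<
      k >>.
  by rewrite -big_split; apply/eq_bigr => k _; rewrite raddfD tensDl.
congr (_ + _).
rewrite {1}(monalgEw (fsubset_trans (fsubsetUl _ _) le_d)) tens_sumr.
apply/eq_bigr => k _; rewrite contractE tensZ; congr tens.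
by apply/malgP => l; rewrite mcoeffZ !mcoeffU mulrnAr mulr1.
Qed.

Section RightExact.
Variables (A B C : lmodType R) (f : {linear A -> B}) (g : {linear B -> C}).
Hypotheses (fg : forall b, g b = 0 -> exists a, f a = b) (g_surj : surj g).

Let im : {pred tensor I B} := fun t => `[< exists u, tensor_map f u = t >].

Fact tensor_im_zmod_closed : zmod_closed im.
Proof.
split; first by apply/asboolP; exists 0; rewrite raddf0.
move=> t u /asboolP[t' <-] /asboolP[u' <-]; apply/asboolP.
by exists (t' - u'); rewrite raddfB.
Qed.

HB.instance Definition _ :=
  GRing.isZmodClosed.Build (tensor I B) im tensor_im_zmod_closed.

(** A set-theoretic section of [g] becomes additive and balanced modulo the image
    of [I (x) A], hence inverts [(I (x) B) / im -> I (x) C]. *)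
Lemma tensor_right_exact (t : tensor I B) :
  tensor_map g t = 0 -> exists u, tensor_map f u = t.
Proof.
pose Q : zmodType := @Quotient.quot (tensor I B) im.
pose pi : {additive tensor I B -> Q} := \pi_Q%qT.
have pi0 u : pi u = 0 <-> exists a, tensor_map f a = u.
  rewrite -(raddf0 pi); split=> [/eqP|[a E]].
    by rewrite -Quotient.idealrBE subr0 => /asboolP.
  by apply/eqP; rewrite -Quotient.idealrBE subr0; apply/asboolP; exists a.
have [s sE] := choice g_surj.
have piE x b b' : g b = g b' -> pi (tens x b) = pi (tens x b').
  move=> gb; have [|a aE] := fg (b := b - b');
    first by rewrite linearB gb subrr.
  have -> : b = b' + f a by rewrite aE addrC subrK.
  rewrite tensDr raddfD /= [X in _ + X](_ : _ = 0) ?addr0 //.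
  by apply/pi0; exists (tens x a); rewrite tensor_mapE.
have [h hE] : exists h : {additive tensor I C -> Q},
    forall x c, h (tens x c) = pi (tens x (s c)).
  apply: (tensor_lift (b := fun x c => pi (tens x (s c)))).
  - by move=> x x' m; rewrite tensDl raddfD.
  - move=> x m m'; rewrite -raddfD -tensDr; apply: piE.
    by rewrite linearD !sE.
  - by move=> x r m; rewrite tensZ; apply: piE; rewrite linearZ /= !sE.
move=> t0; apply/pi0; transitivity (h (tensor_map g t));
  last by rewrite t0 raddf0.
apply: (tensor_ext (g := h \o tensor_map g : {additive _ -> _})) => x b.
by rewrite /= tensor_mapE hE; apply: piE; rewrite sE.
Qed.

End RightExact.

Definition Tor1_zero M : Prop :=
  forall t : tensor I (syzygy1 M), tensor_map (sincl M) t = 0 -> t = 0.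

Lemma Tor1_zero_stable : stable Tor1_zero.
Proof.
move=> M M' /stable_retract_lift[sP [sO [rO [w [sE E]]]]] torM' t t0.
have -> : t = tensor_map rO (tensor_map sO t) + tensor_map w
  (tensor_map (sincl M) t).
  rewrite (tensor_map_comp (h := rO \o sO : {linear _ -> _})) //.
  rewrite (tensor_map_comp (h := w \o sincl M : {linear _ -> _})) //.
  rewrite -(tensor_mapD (h := idfun : {linear _ -> _})) ?tensor_map_id //.
rewrite t0 (torM' (tensor_map sO t)) ?raddf0 ?addr0 //.
rewrite (tensor_map_comp (h := sP \o sincl M : {linear _ -> _})); last first.
  by move=> z; rewrite sE.
by rewrite -(tensor_map_comp (f := sincl M) (g := sP)) // t0 raddf0.
Qed.

(** The start of the long exact sequence:
    [Tor_1 (I, C) -> I (x) A -> I (x) B]. *)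
Lemma Tor1_zero_inj A B C (i : {linear A -> B}) (p : {linear B -> C}) :
  ses i p -> Tor1_zero C ->
  forall t : tensor I A, tensor_map i t = 0 -> t = 0.
Proof.
move=> ip torC t t0; have [i_inj ip_ex p_surj] := ip.
have [b bE] := malg_projective (@cover R C : {linear _ -> _}) p_surj.
have [a aE] : exists a : {linear syzygy1 C -> A}, forall z,
  i (a z) = b (sincl C z).
  apply: (ses_ker_lift (f := b \o sincl C : {linear _ -> _}) ip) => z.
  by rewrite /= bE /= cover_sincl.
(* [B] is the pushout of [A] and the free cover of [C] along the syzygy. *)
pose D : lmodType R := (A * {malg R[C]})%type.
pose j1 : {linear A -> D} := @mk_linear R A D (fun x => (x, 0))
  (fun k x y => congr1 (pair _) (esym (etrans (addr0 _) (scaler0 _ k)))).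
have j2L : linear (fun z : syzygy1 C => (- a z, sincl C z) : D).
  by move=> k x y; congr (_, _); rewrite !linearP // opprD scalerN.
pose j2 := mk_linear j2L.
have gL : linear (fun d : D => i d.1 + b d.2).
  by move=> k x y; rewrite /= !linearP scalerDr addrACA.
pose g := mk_linear gL.
have g_ex d : g d = 0 -> exists z, j2 z = d.
  rewrite /g mk_linearE => /eqP; rewrite addrC addr_eq0 => /eqP dE.
  have [z zE] : exists z, sincl C z = d.2.
    apply: cover_ker; rewrite -bE dE linearN /=.
    by apply/eqP; rewrite oppr_eq0; apply/eqP/ip_ex; exists d.1.
  exists z; rewrite /j2 mk_linearE zE [RHS]surjective_pairing; congr (_, _).
  by apply: i_inj; rewrite linearN aE zE dE opprK.
have g_surj : surj g.
  move=> y; have [|x xE] := (ip_ex (y - b (<< p y >> : {malg R[C]}))).1.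
    by rewrite linearB bE /= coverU subrr.
  by exists (x, << p y >>); rewrite /g mk_linearE /= xE subrK.
have [u uE] : exists u, tensor_map j2 u = tensor_map j1 t.
  apply: (tensor_right_exact g_ex g_surj).
  rewrite (tensor_map_comp (h := i)) // => x.
  by rewrite /g mk_linearE /= linear0 addr0.
have u0 : u = 0.
  apply: torC.
  have := congr1 (tensor_map (snd : {linear D -> {malg R[C]}})) uE.
  rewrite (tensor_map_comp (h := sincl C)) // => ->.
  by rewrite (tensor_map_comp (h := \0 : {linear _ -> _})) //;
    apply: (tensor_ext (g := \0 : {additive _ -> _})) => x m;
    rewrite /= tensor_mapE tens0r.
rewrite -[t](tensor_map_id (f := idfun : {linear _ -> _})) //.
rewrite -(tensor_map_comp (f := j1) (g := fst : {linear D -> A})) //.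
by rewrite -uE u0 !raddf0.
Qed.

End Tensor.

(** The tensor product is functorial in [I] as well, so a retract of [I] inherits
    the vanishing of [Tor]. *)
Lemma tensor_retract (R : nzRingType) (I J : lmodType R^c) (s : {linear I -> J})
    (r : {linear J -> I}) (M : lmodType R) :
  (forall x, r (s x) = x) -> Tor1_zero J M -> Tor1_zero I M.
Proof.
move=> rs torJ t t0.
have mapl (I1 I2 : lmodType R^c) (f : {linear I1 -> I2}) (N : lmodType R) :
    exists h : {additive tensor I1 N -> tensor I2 N}, forall x m,
      h (tens x m) = tens (f x) m.
  apply: (tensor_lift (b := fun x m => tens (f x) m)).
  - by move=> x x' m; rewrite linearD tensDl.
  - by move=> x m m'; rewrite tensDr.
  - by move=> x k m; rewrite linearZ tensZ.
have [sM sME] := mapl _ _ s (syzygy1 M); have [rM rME] :=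
  mapl _ _ r (syzygy1 M).
have [sP sPE] := mapl _ _ s {malg R[M]}.
have -> : t = rM (sM t).
  apply: (tensor_ext (f := idfun : {additive _ -> _})
                     (g := rM \o sM : {additive _ -> _})) => x m /=.
  by rewrite sME rME rs.
rewrite (torJ (sM t)) ?raddf0 // -(raddf0 sP) -t0.
apply: (tensor_ext (f := tensor_map (sincl M) \o sM : {additive _ -> _})
                   (g := sP \o tensor_map (sincl M) : {additive _ -> _})) =>
                     x m.
by rewrite /= sME !tensor_mapE sPE.
Qed.

Arguments contract {R I M} phi.
Arguments mcoeff_lin {R X} k.

(** * Countable rings: vanishing of [Ext] forces vanishing of [Tor] *)

Section LinearImage.
Variables (R : nzRingType) (A B : lmodType R) (f : {linear A -> B}).

Definition limgp : {pred B} := fun b => `[< exists a, f a = b >].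

Fact limgp_submod_closed : submod_closed limgp.
Proof.
split; first by apply/asboolP; exists 0; rewrite linear0.
move=> k x y /asboolP[a <-] /asboolP[b <-]; apply/asboolP.
by exists (k *: a + b); rewrite linearP.
Qed.

HB.instance Definition _ :=
  GRing.isSubmodClosed.Build R B limgp limgp_submod_closed.

Definition limg : Type := {b : B | limgp b}.

HB.instance Definition _ := SubChoice.on limg.
HB.instance Definition _ := [SubChoice_isSubLmodule of limg by <:].

(** Injectivity, tested on the image of [f]. *)
Lemma injective_module_factor (I : lmodType R) (g : {linear A -> I}) :
  injective_module I -> (forall a, f a = 0 -> g a = 0) ->
  exists h : {linear B -> I}, forall a, h (f a) = g a.
Proof.
move=> I_inj fg.
have g_eq a b : f a = f b -> g a = g b.
  move=> fab; apply/eqP; rewrite -subr_eq0 -linearB; apply/eqP/fg.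
  by rewrite linearB fab subrr.
have /choice[s sE] : forall x : limg, exists a, f a = val x.
  by move=> [x /= /asboolP].
have gL : linear (g \o s : limg -> I).
  move=> k x y; rewrite /= -linearP; apply: g_eq.
  by rewrite linearP !sE.
pose v : {linear limg -> B} :=
  @mk_linear R limg B (fun z => val z) (fun a z w => erefl).
have [h hE] := I_inj limg B v (mk_linear gL) val_inj.
have imf a : limgp (f a) by apply/asboolP; exists a.
exists h => a; have := hE (exist _ (f a) (imf a)); rewrite /v mk_linearE /= =>
  ->.
by apply: g_eq; rewrite sE.
Qed.

End LinearImage.

Section CountableRing.
Variables (R : nzRingType) (I : lmodType R^c).
Implicit Types K P : lmodType R.

Lemma contractB P (phi psi chi : {linear P -> R^o}) (t : tensor I P) :
  (forall x, chi x = phi x - psi x) ->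
  contract chi t = contract phi t - contract psi t.
Proof.
move=> E; apply: (tensor_ext (f := contract chi)
  (g := contract phi \- contract psi : {additive _ -> _})) => x m.
by rewrite /= !contractE E scalerBl.
Qed.

Lemma contract_coeff_bound (t : tensor I {malg R[nat]}) :
  exists N, forall q, (N <= q)%N -> contract (mcoeff_lin q) t = 0.
Proof.
have [s ->] := tensorP t; elim: s => [|p s [N IH]].
  by exists 0%N => q _; rewrite big_nil raddf0.
exists (maxn N (\max_(k <- msupp p.2) k).+1) => q.
rewrite geq_max big_cons raddfD /= => /andP[/IH -> lt_q].
rewrite addr0 contractE mcoeff_linE mcoeff_outdom ?scale0r //.
apply/negP => qp; move: lt_q; rewrite ltnNge => /negP; apply.
by rewrite (big_fsetD1 q) //= leq_maxl.
Qed.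

(** An element [T] of [I (x) R^(K)] gives a map from the right module of all
    functions [K -> R] to [I].  If it vanishes on the functions that kill the
    relations [rel j], it factors through [R^q], and extends to [R^q] because [I]
    is injective; the images [y j] of the basis vectors express [T] as the
    combination of the [rel j], which dies in [I (x) K]. *)
Lemma injective_tensor_separation K (T : tensor I {malg R[K]}) q
    (rel : 'I_q -> syzygy1 K) : injective_module I ->
  (forall c : K -> R, (forall j, lin_ext (c : K -> R^o) (sincl K (rel j)) = 0)
    ->
    contract (lin_ext (c : K -> R^o)) T = 0) ->
  tensor_map (@cover R K) T = 0.
Proof.
move=> I_inj kill; pose Rc : lmodType R^c := (R^c)^o.
have lin_extM (c : K -> R^o) (a : R) m :
    lin_ext (fun k => c k * a : R^o) m = lin_ext c m * a.
  by rewrite /lin_ext mulr_suml; apply/eq_bigr => k _; rewrite scalerAl.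
have lin_extD (c d : K -> R^o) m :
    lin_ext (fun k => c k + d k) m = lin_ext c m + lin_ext d m.
  by rewrite /lin_ext -big_split; apply/eq_bigr => k _; rewrite scalerDr.
have lin_ext_lc (a : R^c) (c d : K -> Rc) m :
    lin_ext ((a *: c + d : K -> Rc) : K -> R^o) m =
    lin_ext (c : K -> R^o) m * (a : R) + lin_ext (d : K -> R^o) m.
  exact: etrans (lin_extD (fun k => (c k : R) * a) d m)
                (congr1 (+%R^~ _) (lin_extM c a m)).
have gL : linear (fun c : K -> Rc => contract (lin_ext (c : K -> R^o)) T : I).
  move=> a c d; have [s ->] := tensorP T.
  rewrite /= !raddf_sum. rewrite -big_split.
  apply/eq_bigr => p _; rewrite /= !contractE.
  apply: etrans (congr1 (fun r : R => (r : R^c) *: p.1) (lin_ext_lc a c d p.2))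
    _.
  by rewrite scalerDl; congr (_ + _); rewrite scalerA.
have fL : linear (fun (c : K -> Rc) (j : 'I_q) =>
    lin_ext (c : K -> R^o) (sincl K (rel j)) : Rc).
  move=> a c d; apply/funext => j.
  exact: lin_ext_lc.
have [|h hE] := injective_module_factor (f := mk_linear fL) (g := mk_linear gL)
  I_inj.
  move=> c fc; rewrite mk_linearE; apply: kill => j.
  by have := congr1 (fun u => u j) fc.
pose y j : I := h (fun l => (l == j)%:R).
have hy (u : 'I_q -> Rc) : h u = \sum_j u j *: y j.
  have {1}-> : u = \sum_j u j *: ((fun l => (l == j)%:R) : 'I_q -> Rc).
    apply/funext => l; rewrite fct_sumE (bigD1 l) //= big1 => [|j jl].
      by rewrite addr0 -[RHS]/(u l * (l == l)%:R) eqxx mulr1.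
    by rewrite -[LHS]/(u j * (l == j)%:R) eq_sym (negbTE jl) mulr0.
  by rewrite linear_sum; apply/eq_bigr => j _; rewrite linearZ.
have -> : T = \sum_j tens (y j) (sincl K (rel j)).
  apply/eqP; rewrite -subr_eq0; apply/eqP/tensor_free_eq0 => k.
  rewrite raddfB raddf_sum /=; apply/eqP; rewrite subr_eq0; apply/eqP.
  have := hE (fun l => (l == k)%:R : R); rewrite !mk_linearE hy => E.
  have delta c : lin_ext (fun l => (l == k)%:R : R^o) c = c@_k.
    rewrite /lin_ext; have [kc|kc] := boolP (k \in msupp c).
      rewrite (big_fsetD1 k) //= eqxx -[_ *: _]/(_ * _) mulr1 big1_fset ?addr0
        //.
      by move=> l; rewrite !inE => /andP[/negbTE -> _] _; rewrite scaler0.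
    rewrite mcoeff_outdom // big1_fset // => l lc _; case: eqP => [lk|_].
      by rewrite -lk lc in kc.
    by rewrite scaler0.
  transitivity (contract (lin_ext (fun l => (l == k)%:R : R^o)) T).
    have [s ->] := tensorP T; rewrite !raddf_sum; apply/eq_bigr => p _ /=.
    by rewrite !contractE; congr (_ *: _); apply: esym (delta _).
  apply: etrans (esym E) _; apply/eq_bigr => j _; rewrite contractE.
  by congr (_ *: _); apply: delta.
rewrite raddf_sum big1 // => j _ /=.
by rewrite tensor_mapE /= cover_sincl tens0r.
Qed.

(** If an element of [I (x) K] died in [I (x) P] without vanishing, then
    injectivity would give for each [q] a linear form on [R^(K)] that kills the
    first [q] relations but not the element.  Together these forms map the
    relations to finitely supported sequences; a correction supplied by
    [Ext^1(K, R^(nat)) = 0] makes all of them descend to [K], then extend to [P],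
    whereas only finitely many of them have been changed on the element. *)
Lemma countable_Tor_injective K P (i : {linear K -> P}) :
  ctbl R -> ctbl K -> injective_module I ->
  (forall h : {linear K -> R^o}, exists e : {linear P -> R^o}, forall k,
    e (i k) = h k) ->
  Ext1_zero K {malg R[nat]} ->
  forall t : tensor I K, tensor_map i t = 0 -> t = 0.
Proof.
move=> ctR ctK I_inj ext_i ext1 t t0.
have [rel rel_surj] : ctbl (syzygy1 K).
  by apply: (ctbl_sub (0 : lker (@cover R K))); apply: ctbl_malg.
have [T TE] := tensor_map_surj (I := I) (@cover_surj R K) t.
apply: contrapT => t_neq0.
have /choice[c cP] : forall q, exists c : K -> R^o,
    (forall j, (j < q)%N -> lin_ext c (sincl K (rel j)) = 0) /\
    contract (lin_ext c) T <> 0.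
  move=> q; apply: contrapT => nc; apply: t_neq0; rewrite -TE.
  apply: (injective_tensor_separation (rel := fun j : 'I_q => rel j)) =>
    // c cj.
  apply: contrapT => cT; apply: nc; exists c; split=> // j jq.
  exact: (cj (Ordinal jq)).
have /choice[u uE] : forall z, exists m : {malg R[nat]},
    forall q, m@_q = lin_ext (c q) (sincl K z).
  move=> z; have [N <-] := rel_surj z.
  exists (\sum_(q < N.+1) << lin_ext (c q) (sincl K (rel N)) *g (q : nat) >>) =>
    q.
  rewrite raddf_sum /=; have [qN|Nq] := ltnP q N.+1.
    rewrite (bigD1 (Ordinal qN)) //= mcoeffUU big1 ?addr0 // => l lq.
    rewrite mcoeffU; case: eqP => // E; case/eqP: lq; exact: val_inj.
  rewrite (cP q).1 // big1 // => l _; rewrite mcoeffU; case: eqP => // E.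
  by move: (ltn_ord l); rewrite E ltnNge Nq.
have uL : linear u.
  by move=> a x y; apply/malgP => q; rewrite mcoeffD mcoeffZ !uE !linearP.
have [psi psiE] := ext1 (mk_linear uL).
have thetaE q : exists theta : {linear K -> R^o},
    forall b, theta (cover b) = lin_ext (c q) b - (psi b)@_q.
  pose th : {linear {malg R[K]} -> R^o} :=
    lin_ext (c q) \- (mcoeff_lin q \o psi).
  have [|th' th'E] := ses_coker_lift (f := th) (ses_syzygy K).
    by move=> z; rewrite /th /= psiE mk_linearE uE subrr.
  by exists th' => b; rewrite th'E.
have [N NP] := contract_coeff_bound (tensor_map psi T).
have [theta thE] := thetaE N; have [d dE] := ext_i theta.
have := contract_map dE t; rewrite t0 raddf0 -TE.
rewrite (contract_map (f := @cover R K)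
  (psi := theta \o @cover R K : {linear _ -> _})) //.
rewrite (contractB (phi := lin_ext (c N))
  (psi := mcoeff_lin N \o psi : {linear _ -> _})).
  rewrite -(contract_map (f := psi) (phi := mcoeff_lin N)
    (psi := mcoeff_lin N \o psi : {linear _ -> _})) // NP // subr0 => E.
  by have [_] := cP N; rewrite -E.
by move=> b; rewrite /= thE.
Qed.

End CountableRing.

(** * Modules over a group ring *)

Definition gr (G : groupType) (g : G) : group_ring G := << g >>.

Section GroupRingModules.
Variable G : groupType.
Local Notation R := (group_ring G).

Lemma gr1 : gr (1%g : G) = 1.
Proof. by []. Qed.

Lemma grM (g h : G) : gr (g * h)%g = gr g * gr h.
Proof. by rewrite -[RHS]/(gr_mul << g >> << h >>) gr_mulUU mulr1. Qed.

Lemma gr_sum (r : R) : r = \sum_(g <- msupp r) gr g *~ r@_g.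
Proof.
rewrite {1}(monalgE r); apply/eq_bigr => g _; apply/malgP => k.
by rewrite raddfMz /= /gr !mcoeffU -mulrzr intz mulrnAl mul1r.
Qed.

Lemma gr_scaleE (V : lmodType R) (r : R) (v : V) :
  r *: v = \sum_(g <- msupp r) (gr g *: v) *~ r@_g.
Proof. by rewrite {1}(gr_sum r) scaler_suml; apply/eq_bigr => g _;
  rewrite scalerMzl. Qed.

Lemma gr_scaleEr (V : lmodType R^c) (r : R) (v : V) :
  (r : R^c) *: v = \sum_(g <- msupp r) ((gr g : R^c) *: v) *~ r@_g.
Proof.
rewrite {1}(gr_sum r : (r : R^c) = _) scaler_suml.
by apply/eq_bigr => g _; rewrite -scalerMzl.
Qed.

Lemma gr_scaleM (V : lmodType R) (g h : G) (v : V) :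
  gr (g * h)%g *: v = gr g *: (gr h *: v).
Proof. by rewrite grM scalerA. Qed.

Lemma gr_scale1 (V : lmodType R) (v : V) : gr (1%g : G) *: v = v.
Proof. by rewrite gr1 scale1r. Qed.

Lemma gr_scaleK (V : lmodType R) (g : G) (v : V) : gr g *: (gr g^-1%g *: v) = v.
Proof. by rewrite -gr_scaleM mulgV gr_scale1. Qed.

Lemma equivariant_linear (V W : lmodType R) (f : V -> W) : zmod_morphism f ->
  (forall g v, f (gr g *: v) = gr g *: f v) -> linear f.
Proof.
move=> fB fg; pose F := mk_additive fB => a x y.
have -> : f (a *: x + y) = f (a *: x) + f y by apply: (raddfD F).
congr (_ + _); rewrite !gr_scaleE;
  transitivity (F (\sum_(g <- msupp a) (gr g *: x) *~ a@_g)).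
  by [].
by rewrite raddf_sum; apply/eq_bigr => g _; rewrite raddfMz /F mk_additiveE fg.
Qed.

Lemma equivariant_linear_r (V W : lmodType R^c) (f : V -> W) : zmod_morphism f
    ->
  (forall g v, f ((gr g : R^c) *: v) = (gr g : R^c) *: f v) -> linear f.
Proof.
move=> fB fg; pose F := mk_additive fB => a x y.
have -> : f (a *: x + y) = f (a *: x) + f y by apply: (raddfD F).
congr (_ + _); rewrite !gr_scaleEr;
  transitivity (F (\sum_(g <- msupp a) ((gr g : R^c) *: x) *~ a@_g)).
  by [].
by rewrite raddf_sum; apply/eq_bigr => g _; rewrite raddfMz /F mk_additiveE fg.
Qed.

Section Action.
Variables (V : zmodType) (act : G -> V -> V).
Hypotheses (actB : forall g, zmod_morphism (act g))
    (act1 : forall v, act 1%g v = v).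

Definition ascale (r : R) (v : V) : V :=
  lin_ext (fun g => act g v : zmodule V) r.

Lemma ascaleU (n : int) g v : ascale << n *g g >> v = act g v *~ n.
Proof. by rewrite /ascale lin_extU scalezrE. Qed.

Lemma ascale_gr g v : ascale (gr g) v = act g v.
Proof. by rewrite /gr ascaleU mulr1z. Qed.

Lemma ascale_morph_l v : zmod_morphism (ascale ^~ v).
Proof. by move=> r s; rewrite /ascale raddfB. Qed.

Lemma ascale_morph_r r : zmod_morphism (ascale r).
Proof.
move=> v w; rewrite /ascale /lin_ext -sumrB; apply/eq_bigr => g _.
by rewrite actB scalerBr.
Qed.

Lemma ascaleDl v r s : ascale (r + s) v = ascale r v + ascale s v.
Proof. exact: (raddfD (mk_additive (ascale_morph_l v))). Qed.

Lemma ascaleDr r v w : ascale r (v + w) = ascale r v + ascale r w.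
Proof. exact: (raddfD (mk_additive (ascale_morph_r r))). Qed.

Lemma ascale_suml v (T : Type) (s : seq T) F :
  ascale (\sum_(i <- s) F i) v = \sum_(i <- s) ascale (F i) v.
Proof. exact: (raddf_sum (mk_additive (ascale_morph_l v))). Qed.

Lemma ascale_sumr r (T : Type) (s : seq T) F :
  ascale r (\sum_(i <- s) F i) = \sum_(i <- s) ascale r (F i).
Proof. exact: (raddf_sum (mk_additive (ascale_morph_r r))). Qed.

Lemma act_mulz g v n : act g (v *~ n) = act g v *~ n.
Proof. exact: (raddfMz (mk_additive (actB g))). Qed.

Lemma ascale1 v : ascale 1 v = v.
Proof. by rewrite -gr1 ascale_gr act1. Qed.

Lemma ascaleA : (forall g h v, act g (act h v) = act (g * h)%g v) ->
  forall r s v, ascale r (ascale s v) = ascale (r * s) v.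
Proof.
move=> actM r s v; rewrite -[r * s]/(gr_mul r s) (monalgE r) gr_mul_suml
  !ascale_suml.
apply/eq_bigr => g _; rewrite (monalgE s) gr_mul_sumr !ascale_suml ascale_sumr.
apply/eq_bigr => h _; rewrite gr_mulUU !ascaleU act_mulz actM.
by rewrite mulrC mulrzA.
Qed.

Lemma ascaleAr : (forall g h v, act g (act h v) = act (h * g)%g v) ->
  forall (r s : R^c) v, ascale r (ascale s v) = ascale (r * s : R^c) v.
Proof.
move=> actM r s v; rewrite -[r * s]/(gr_mul s r).
rewrite (monalgE s) gr_mul_suml !ascale_suml ascale_sumr.
apply/eq_bigr => h _; rewrite (monalgE r) gr_mul_sumr !ascale_suml.
apply/eq_bigr => g _; rewrite gr_mulUU !ascaleU act_mulz actM.
by rewrite mulrzA.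
Qed.

End Action.
End GroupRingModules.

Section Trivial.
Variables (G : groupType) (W : zmodType).

Definition triv : Type := let _ := G in W.
HB.instance Definition _ := GRing.Zmodule.on triv.

Let act (g : G) (w : triv) : triv := w.
Let actB g : zmod_morphism (act g). Proof. by []. Qed.
Let act1 v : act 1%g v = v. Proof. by []. Qed.

HB.instance Definition _ := GRing.Zmodule_isLmodule.Build (group_ring G) triv
  (ascaleA actB (fun g h v => erefl)) (ascale1 act1)
  (ascaleDr actB) (ascaleDl act).

Lemma triv_scale (g : G) (w : triv) : gr g *: w = w.
Proof. exact: ascale_gr. Qed.

End Trivial.

Section Coinduced.
Variables (G : groupType) (W : zmodType).

(** Coinduction [Hom_Z (Z[G], W)], as functions on [G]. *)
Definition coind : Type := G -> W.
HB.instance Definition _ := GRing.Zmodule.on coind.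

Let act (g : G) (f : coind) : coind := fun x => f (g^-1 * x)%g.
Let actB g : zmod_morphism (act g). Proof. by []. Qed.
Let act1 v : act 1%g v = v.
Proof. by apply/funext => x; rewrite /act invg1 mul1g. Qed.
Let actM g h v : act g (act h v) = act (g * h)%g v.
Proof. by apply/funext => x; rewrite /act invgM mulgA. Qed.

HB.instance Definition _ := GRing.Zmodule_isLmodule.Build (group_ring G) coind
  (ascaleA actB actM) (ascale1 act1) (ascaleDr actB) (ascaleDl act).

Lemma coind_scale (g : G) (f : coind) x : (gr g *: f) x = f (g^-1 * x)%g.
Proof. exact: (congr1 (fun u : coind => u x) (ascale_gr act g f)). Qed.

End Coinduced.

Section RightCoinduced.
Variables (H G : groupType) (iota : {multiplicative H -> G}) (W : zmodType).

Lemma iota1 : iota 1%g = 1%g.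
Proof. by apply: (mulgI (iota 1%g)); rewrite -gmulfM !mulg1. Qed.

Lemma iotaV h : iota h^-1%g = (iota h)^-1%g.
Proof. by apply: (mulgI (iota h)); rewrite -gmulfM !mulgV iota1. Qed.

(** The right module with the same elements as [coind G W].  The group acting is
    allowed to be any [H] mapping to [G], so that restriction to a subgroup changes
    nothing but the scalars. *)
Definition rcoind : Type := let _ := iota in G -> W.
HB.instance Definition _ := GRing.Zmodule.on rcoind.

Let act (h : H) (f : rcoind) : rcoind := fun x => f (iota h * x)%g.
Let actB g : zmod_morphism (act g). Proof. by []. Qed.
Let act1 v : act 1%g v = v.
Proof. by apply/funext => x; rewrite /act iota1 mul1g. Qed.
Let actM g h v : act g (act h v) = act (h * g)%g v.
Proof. by apply/funext => x; rewrite /act gmulfM mulgA. Qed.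

HB.instance Definition _ := GRing.Zmodule_isLmodule.Build (group_ring H)^c
  rcoind
  (ascaleAr actB actM) (ascale1 act1) (ascaleDr actB) (ascaleDl act).

Lemma rcoind_scale (h : H) (f : rcoind) x :
  ((gr h : (group_ring H)^c) *: f) x = f (iota h * x)%g.
Proof. exact: (congr1 (fun u : rcoind => u x) (ascale_gr act h f)). Qed.

End RightCoinduced.

Section ZHom.
Variables (G : groupType) (A B : lmodType (group_ring G)).

Definition zhomp : {pred A -> B} := fun f => `[< zmod_morphism f >].

Fact zhomp_zmod_closed : zmod_closed zhomp.
Proof.
split; first by apply/asboolP => x y; rewrite -[RHS]/(0 - 0) subrr.
move=> f g /asboolP fB /asboolP gB; apply/asboolP => x y.
rewrite -[LHS]/(f (x - y) - g (x - y)) -[RHS]/((f x - g x) - (f y - g y)).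
by rewrite fB gB !opprD addrACA.
Qed.

HB.instance Definition _ := GRing.isZmodClosed.Build (A -> B) zhomp
  zhomp_zmod_closed.

(** [Hom_Z (A, B)] with the diagonal action. *)
Definition zhom : Type := {f : A -> B | zhomp f}.

HB.instance Definition _ := SubChoice.on zhom.
HB.instance Definition _ := [SubChoice_isSubZmodule of zhom by <:].

Definition zapp (f : zhom) : A -> B := val f.

Lemma zappB (f : zhom) : zmod_morphism (zapp f).
Proof. exact/asboolP/(valP f). Qed.

Lemma zhom_ext (f g : zhom) : (forall a, zapp f a = zapp g a) -> f = g.
Proof. by move=> fg; apply/val_inj/funext. Qed.

Definition mk_zhom (f : A -> B) (fB : zmod_morphism f) : zhom :=
  exist _ f (introT (asboolP _) fB).

Lemma mk_zhomE f (fB : zmod_morphism f) a : zapp (mk_zhom fB) a = f a.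
Proof. by []. Qed.

Lemma zappBl (f g : zhom) a : zapp (f - g) a = zapp f a - zapp g a.
Proof. by []. Qed.

Fact zact_morph (g : G) (f : zhom) :
  zmod_morphism (fun a => gr g *: zapp f (gr g^-1%g *: a)).
Proof. by move=> x y; rewrite scalerBr zappB scalerBr. Qed.

Let act (g : G) (f : zhom) : zhom := mk_zhom (zact_morph g f).
Let actB g : zmod_morphism (act g).
Proof. by move=> x y; apply: zhom_ext => a;
  rewrite zappBl !mk_zhomE zappBl scalerBr. Qed.
Let act1 v : act 1%g v = v.
Proof. by apply: zhom_ext => a; rewrite mk_zhomE invg1 !gr_scale1. Qed.
Let actM g h v : act g (act h v) = act (g * h)%g v.
Proof.
apply: zhom_ext => a; rewrite [RHS]mk_zhomE invgM gr_scaleM.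
by rewrite (gr_scaleM h^-1%g).
Qed.

HB.instance Definition _ := GRing.Zmodule_isLmodule.Build (group_ring G) zhom
  (ascaleA actB actM) (ascale1 act1) (ascaleDr actB) (ascaleDl act).

Lemma zhom_scale (g : G) (f : zhom) a :
  zapp (gr g *: f) a = gr g *: zapp f (gr g^-1%g *: a).
Proof. exact: (congr1 (fun u => zapp u a) (ascale_gr act g f)). Qed.

Lemma zapp0 (f : zhom) : zapp f 0 = 0.
Proof. exact: (raddf0 (mk_additive (zappB f))). Qed.

Lemma zappD (f : zhom) a b : zapp f (a + b) = zapp f a + zapp f b.
Proof. exact: (raddfD (mk_additive (zappB f))). Qed.

Lemma zhom_divisible : divisible B ->
    (forall (n : nat) (b : B), (0 < n)%N -> b *+ n = 0 -> b = 0) ->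
  divisible zhom.
Proof.
move=> B_div B_tf n f n_gt0; have [d dE] := choice (fun b => B_div n b n_gt0).
have dB : zmod_morphism (fun a => d (zapp f a)).
  move=> x y; apply/eqP; rewrite -subr_eq0; apply/eqP/(B_tf n) => //.
  by rewrite !mulrnBl !dE zappB subrr.
exists (mk_zhom dB); apply: zhom_ext => a; rewrite -[RHS]dE -(mk_zhomE dB a).
elim: n {n_gt0 dE} => [|n IH]; first by rewrite !mulr0n.
by rewrite !mulrS -IH.
Qed.

End ZHom.

Section ZHomTheory.
Variable G : groupType.
Local Notation R := (group_ring G).
Implicit Types A B C U P : lmodType R.

Fact zpre_morph A C B (f : {linear A -> C}) (h : zhom C B) :
  zmod_morphism (fun a => zapp h (f a)).
Proof. by move=> x y; rewrite linearB zappB. Qed.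

Fact zpre_linear A C B (f : {linear A -> C}) :
  linear (fun h : zhom C B => mk_zhom (zpre_morph f h)).
Proof.
apply: equivariant_linear => [h k|g h]; first by apply: zhom_ext.
apply: zhom_ext => a; rewrite mk_zhomE !zhom_scale mk_zhomE.
by rewrite linearZ.
Qed.

Definition zpre A C B (f : {linear A -> C}) : {linear zhom C B -> zhom A B} :=
  mk_linear (zpre_linear f).

Lemma zpreE A C B (f : {linear A -> C}) (h : zhom C B) a :
  zapp (zpre B f h) a = zapp h (f a).
Proof. by []. Qed.

(** Both sides are the equivariant bilinear maps on [U] and [A]. *)
Lemma swap_zhom U A B (h : {linear U -> zhom A B}) :
  exists k : {linear A -> zhom U B}, forall a u, zapp (k a) u = zapp (h u) a.
Proof.
have kB a : zmod_morphism (fun u => zapp (h u) a).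
  by move=> x y; rewrite linearB zappBl.
have kL : linear (fun a => mk_zhom (kB a)).
  apply: equivariant_linear => [a b|g a].
    by apply: zhom_ext => u; rewrite zappBl !mk_zhomE zappB.
  apply: zhom_ext => u; rewrite zhom_scale !mk_zhomE linearZ zhom_scale.
  by rewrite invgK gr_scaleK.
by exists (mk_linear kL).
Qed.

Lemma zhom_ses A1 A2 A3 B (i : {linear A1 -> A2}) (p : {linear A2 -> A3}) :
  divisible B -> ses i p -> ses (zpre B p) (zpre B i).
Proof.
move=> B_div ip; have [i_inj ip_ex p_surj] := ip; split.
- move=> h k E; apply: zhom_ext => c; have [a <-] := p_surj c.
  by rewrite -!zpreE E.
- move=> h; split=> [h0|[k <-]]; last first.
    apply: zhom_ext => a; rewrite !zpreE (_ : p (i a) = 0) ?zapp0 //.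
    by apply/ip_ex; exists a.
  have [s sE] := choice p_surj.
  have h_eq a b : p a = p b -> zapp h a = zapp h b.
    move=> pab; have [|c cE] := (ip_ex (a - b)).1;
      first by rewrite linearB pab subrr.
    by apply/eqP; rewrite -subr_eq0 -zappB -cE -zpreE h0.
  have kB : zmod_morphism (fun c => zapp h (s c)).
    by move=> x y; rewrite -zappB; apply: h_eq; rewrite linearB !sE.
  exists (mk_zhom kB); apply: zhom_ext => a; rewrite zpreE mk_zhomE.
  by apply: h_eq; rewrite sE.
move=> h; have [k kE] := divisible_extend (mk_additive (zappB h)) i_inj B_div.
have kB : zmod_morphism k by move=> x y; rewrite raddfB.
by exists (mk_zhom kB); apply: zhom_ext => a; rewrite zpreE mk_zhomE kE.
Qed.

(** [Hom_Z (P, B)] is coinduced when [P] is free, hence acyclic. *)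
Lemma Ext1_zhom_projective U P B :
  divisible B -> projective P -> Ext1_zero U (zhom P B).
Proof.
move=> B_div Pproj h; have [k kE] := swap_zhom h.
have [_ _ r_surj] := zhom_ses B_div (ses_syzygy U).
have [l lE] := Pproj _ _ _ k r_surj; have [e eE] := swap_zhom l.
exists e => z; apply: zhom_ext => x.
by rewrite eE -kE -zpreE lE.
Qed.

(** Balance of [Ext], for coefficients that are injective as abelian groups:
    both sides are [Ext^1(U (x) A, B)]. *)
Lemma Ext1_zhom_swap U A B :
  divisible B -> Ext1_zero A (zhom U B) -> Ext1_zero U (zhom A B).
Proof.
move=> B_div ext h; have [k kE] := swap_zhom h.
have [l lE] := Ext1_zero_lift (zhom_ses B_div (ses_syzygy U)) ext k.
have [e eE] := swap_zhom l; exists e => z; apply: zhom_ext => x.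
by rewrite eE -kE -zpreE lE.
Qed.

(** The syzygies are moved one at a time from [U] to [A], along the sequences
    [Hom (A, B) -> Hom (R^(A), B) -> Hom (syzygy A, B)] whose middle term is
    acyclic. *)
Lemma Ext1_zhom_balance U A B a : divisible B ->
  Ext1_zero (syzygy A a) (zhom U B) -> Ext1_zero (syzygy U a) (zhom A B).
Proof.
move=> B_div /(Ext1_zhom_swap B_div); elim: a A => //= a IH A ext.
apply: (Ext1_zero_syzygy (zhom_ses B_div (ses_syzygy A))).
  by apply: Ext1_zhom_projective => //; apply: malg_projective.
by apply: IH; move: ext; rewrite -iterS iterSr.
Qed.

End ZHomTheory.

(** * Restriction and induction along an inclusion of groups *)

Section MalgAdditive.
Variables (K : choiceType) (A V : zmodType).

Section Sum.
Variables (F : K -> A -> V) (FB : forall k, zmod_morphism (F k)).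

Definition msum (u : {malg A[K]}) : V := \sum_(k <- msupp u) F k u@_k.

Lemma msumw (d : {fset K}) u : msupp u `<=` d ->
    msum u = \sum_(k <- d) F k u@_k.
Proof.
move=> le_d; rewrite /msum (big_fset_incl _ le_d) //= => k _ /mcoeff_outdom ->.
exact: (raddf0 (mk_additive (FB k))).
Qed.

Lemma msum_morph : zmod_morphism msum.
Proof.
move=> u v; pose d := msupp u `|` msupp v.
rewrite (msumw (fsubsetUl _ _ : _ `<=` d)) (msumw (fsubsetUr _ _ : _ `<=` d)).
rewrite (msumw (msuppB_le _ _ : _ `<=` d)) -sumrB; apply/eq_bigr => k _.
by rewrite mcoeffB FB.
Qed.

Lemma msumU k a : msum << a *g k >> = F k a.
Proof. by rewrite (msumw msuppU_le) big_seq_fset1 mcoeffUU. Qed.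

End Sum.

Lemma malg_additive_ext (f g : {additive {malg A[K]} -> V}) :
  (forall k a, f << a *g k >> = g << a *g k >>) -> forall u, f u = g u.
Proof.
move=> fg u; rewrite (monalgE u) !raddf_sum; apply/eq_bigr => k _; exact: fg.
Qed.

End MalgAdditive.

Section MalgMap.
Variables (K : choiceType) (A B : zmodType) (f : {additive A -> B}).

Fact malg_map_morph k : zmod_morphism (fun a => << f a *g k >> : {malg B[K]}).
Proof. by move=> x y; rewrite !raddfB. Qed.

Fact malg_map_key : {g : {additive {malg A[K]} -> {malg B[K]}} |
  forall k a, g << a *g k >> = << f a *g k >>}.
Proof.
exists (mk_additive (msum_morph malg_map_morph)); exact: (msumU malg_map_morph).
Qed.

Definition malg_map : {additive {malg A[K]} -> {malg B[K]}} :=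
  sval malg_map_key.

Lemma malg_mapU k a : malg_map << a *g k >> = << f a *g k >>.
Proof. exact: (svalP malg_map_key). Qed.

Lemma malg_mapE u k : (malg_map u)@_k = f u@_k.
Proof.
apply: (malg_additive_ext (f := mcoeff k \o malg_map : {additive _ -> _})
  (g := f \o mcoeff k : {additive _ -> _})) => l a.
by rewrite /= malg_mapU !mcoeffU raddfMn.
Qed.

End MalgMap.

Arguments malg_map {K A B} f.

Lemma gr_additive_ext (G : groupType) (V : zmodType)
    (f g : {additive group_ring G -> V}) :
  (forall x, f (gr x) = g (gr x)) -> forall r, f r = g r.
Proof.
move=> fg r; rewrite (gr_sum r) !raddf_sum; apply/eq_bigr => x _.
by rewrite !raddfMz /= fg.
Qed.

Section Restriction.
Variables (H G : groupType) (iota : {multiplicative H -> G}).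
Local Notation RH := (group_ring H).
Local Notation RG := (group_ring G).

Section Res.
Variable V : lmodType RG.

Definition res : Type := let _ := iota in V.
HB.instance Definition _ := GRing.Zmodule.on res.

Let act (h : H) (v : res) : res := gr (iota h) *: (v : V).
Let actB g : zmod_morphism (act g). Proof. by move=> x y; apply: scalerBr. Qed.
Let act1 v : act 1%g v = v. Proof. by rewrite /act iota1 gr_scale1. Qed.
Let actM g h v : act g (act h v) = act (g * h)%g v.
Proof. by rewrite /act gmulfM gr_scaleM. Qed.

HB.instance Definition _ := GRing.Zmodule_isLmodule.Build RH res
  (ascaleA actB actM) (ascale1 act1) (ascaleDr actB) (ascaleDl act).

Lemma res_scale (h : H) (v : res) : gr h *: v = gr (iota h) *: (v : V) :> V.
Proof. exact: (ascale_gr act h v). Qed.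

End Res.

Lemma res_map_linear (V W : lmodType RG) (f : {linear V -> W}) :
  linear (f : res V -> res W).
Proof.
apply: equivariant_linear => [x y|h v]; first exact: linearB.
by rewrite res_scale linearZ res_scale.
Qed.

Fact gr_push_key : {f : {additive RH -> RG} | forall h, f (gr h) = gr (iota h)}.
Proof.
exists (mk_additive (ascale_morph_l (fun h (_ : RG) => gr (iota h)) 0)) => h.
by rewrite mk_additiveE ascale_gr.
Qed.

Definition gr_push : {additive RH -> RG} := sval gr_push_key.

Lemma gr_pushE h : gr_push (gr h) = gr (iota h).
Proof. exact: (svalP gr_push_key). Qed.

Lemma gr_push_mul h r : gr_push (gr h * r) = gr (iota h) * gr_push r.
Proof.
have mulB (S : nzRingType) (a : S) : zmod_morphism ( *%R a) by move=> x y;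
  rewrite mulrBr.
apply: (gr_additive_ext (f := gr_push \o mk_additive (mulB _ (gr h))
  : {additive _ -> _})
  (g := mk_additive (mulB _ (gr (iota h))) \o gr_push : {additive _ -> _})) =>
    x.
by rewrite /= -grM gr_pushE gr_pushE gmulfM grM.
Qed.

Lemma res_scale_push (V : lmodType RG) (r : RH) (v : res V) :
  r *: v = gr_push r *: (v : V) :> V.
Proof.
have scB (S : nzRingType) (W : lmodType S) (w : W) : zmod_morphism ( *:%R^~ w).
  by move=> x y; rewrite scalerBl.
apply: (gr_additive_ext (f := mk_additive (scB _ (res V) v))
  (g := mk_additive (scB _ V v) \o gr_push : {additive _ -> V})) => x.
by rewrite /= gr_pushE res_scale.
Qed.

Hypothesis iota_inj : injective iota.

Lemma gr_push_coeff r h : (gr_push r)@_(iota h) = r@_h.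
Proof.
have cf : zmod_morphism (fun r : RH => (r : {malg int[H]})@_h) by move=> x y;
  rewrite mcoeffB.
have cg : zmod_morphism (fun r : RH => (gr_push r : {malg int[G]})@_(iota h)).
  by move=> x y; rewrite raddfB mcoeffB.
apply: (gr_additive_ext (f := mk_additive cg) (g := mk_additive cf)) => x.
by rewrite !mk_additiveE gr_pushE /gr !mcoeffU (inj_eq iota_inj).
Qed.

Lemma gr_push_inj : injective gr_push.
Proof.
move=> r s rs; apply/malgP => h; rewrite -!gr_push_coeff.
by rewrite rs.
Qed.

Fact gr_pull_key : {f : {additive RG -> RH} | (forall h, f (gr (iota h)) = gr h)
    /\
  forall g, ~ (exists h, iota h = g) -> f (gr g) = 0}.
Proof.
pose pull g : RH :=
  if pselect (exists h, iota h = g) is left ex then gr (projT1 (cid ex)) else 0.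
exists (mk_additive (ascale_morph_l (fun g (_ : RH) => pull g) 0)).
split=> [h|g ng]; rewrite mk_additiveE ascale_gr /pull; case: pselect => //.
  by move=> ex; case: cid => /= k /iota_inj ->.
by case; exists h.
Qed.

Definition gr_pull : {additive RG -> RH} := sval gr_pull_key.

Lemma gr_pullE h : gr_pull (gr (iota h)) = gr h.
Proof. exact: (svalP gr_pull_key).1. Qed.

Lemma gr_pull0 g : ~ (exists h, iota h = g) -> gr_pull (gr g) = 0.
Proof. exact: (svalP gr_pull_key).2. Qed.

Lemma gr_pull_push r : gr_pull (gr_push r) = r.
Proof.
apply: (gr_additive_ext (f := gr_pull \o gr_push : {additive _ -> _})
  (g := idfun : {additive _ -> _})) => x.
by rewrite /= gr_pushE gr_pullE.
Qed.

Lemma gr_pull_mul h r : gr_pull (gr (iota h) * r) = gr h * gr_pull r.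
Proof.
have mulB (S : nzRingType) (a : S) : zmod_morphism ( *%R a) by move=> x y;
  rewrite mulrBr.
apply: (gr_additive_ext (f := gr_pull \o mk_additive (mulB _ (gr (iota h)))
  : {additive _ -> _})
  (g := mk_additive (mulB _ (gr h)) \o gr_pull : {additive _ -> _})) => x.
rewrite /= -grM; have [[k <-]|nx] := pselect (exists k, iota k = x).
  by rewrite -gmulfM !gr_pullE grM.
rewrite (gr_pull0 nx) mulr0 gr_pull0 // => -[k kE]; apply: nx.
by exists (h^-1 * k)%g; apply: (mulgI (iota h)); rewrite -gmulfM mulVKg.
Qed.

Lemma malg_push_equivariant (K : choiceType) (h : H) (c : {malg RH[K]}) :
  malg_map gr_push (gr h *: c) = gr (iota h)
    *: (malg_map gr_push c : {malg RG[K]}).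
Proof. by apply/malgP => k; rewrite !(malg_mapE, mcoeffZ) gr_push_mul. Qed.

Lemma malg_pull_equivariant (K : choiceType) (h : H) (c : {malg RG[K]}) :
  malg_map gr_pull (gr (iota h) *: c) = gr h
    *: (malg_map gr_pull c : {malg RH[K]}).
Proof. by apply/malgP => k; rewrite !(malg_mapE, mcoeffZ) gr_pull_mul. Qed.

(** An identification of [G], as a right [H]-set, with a product [tT * H]. *)
Record transversal := Transversal {
  tT : choiceType; tr : tT -> G; tau : G -> tT; eta : G -> H;
  trE : forall x, x = (tr (tau x) * iota (eta x))%g;
  tauE : forall t h, tau (tr t * iota h)%g = t;
  etaE : forall t h, eta (tr t * iota h)%g = h }.

Lemma transversal_exists : inhabited transversal.
Proof.
pose P x : pred G := fun y => `[< exists h, x = (y * iota h)%g >].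
have Pxx x : P x x by apply/asboolP; exists 1%g; rewrite iota1 mulg1.
pose rep x := choose (P x) x.
have repP x : P x (rep x) by apply: chooseP; apply: Pxx.
have /choice[eta etaP] : forall x, exists h, x = (rep x * iota h)%g.
  by move=> x; apply/asboolP/repP.
have rep_eq x h : rep (x * iota h)%g = rep x.
  have PP : P (x * iota h)%g =1 P x.
    move=> y; apply/asboolP/asboolP => -[k kE].
      by exists (k * h^-1)%g; apply: (mulIg (iota h));
        rewrite kE -mulgA -gmulfM mulgVK.
    by exists (k * h)%g; rewrite kE gmulfM mulgA.
  rewrite /rep (eq_choose PP); apply: choose_id; first by rewrite -PP.
  exact: Pxx.
have rep_id x : rep (rep x) = rep x.
  by rewrite -{2}[x]/(x) {2}(etaP x) rep_eq.
pose T : choiceType := {x : G | rep x == x}.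
pose tau x : T := exist _ (rep x) (introT eqP (rep_id x)).
constructor; apply: (@Transversal T val tau eta) => [x|t h|t h];
  first exact: etaP.
  by apply/val_inj; rewrite /= rep_eq; apply/eqP/(valP t).
apply: iota_inj; apply: (mulgI (val t)); rewrite [RHS](etaP (val t * iota h)%g).
by rewrite rep_eq (eqP (valP t)).
Qed.

Section Induced.
Variable X : transversal.

Lemma tau_mul x h : tau X (x * iota h)%g = tau X x.
Proof. by rewrite {1}(trE X x) -mulgA -gmulfM tauE. Qed.

Lemma eta_mul x h : eta X (x * iota h)%g = (eta X x * h)%g.
Proof. by rewrite {1}(trE X x) -mulgA -gmulfM etaE. Qed.

Lemma tau_tr (t : tT X) : tau X (tr t) = t.
Proof. by rewrite -[tr t]mulg1 -(iota1 iota) tauE. Qed.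

Lemma eta_tr (t : tT X) : eta X (tr t) = 1%g.
Proof. by rewrite -[tr t]mulg1 -(iota1 iota) etaE. Qed.

Section Ind.
Variable L : lmodType RH.

(** The induced module, a direct sum of copies of [L] indexed by cosets. *)
Definition ind : Type := {malg L[tT X]}.
HB.instance Definition _ := GRing.Zmodule.on ind.

(** The tensor [x (x) l]. *)
Definition ind_tens (x : G) (l : L) : ind := << gr (eta X x) *: l *g tau X x >>.

Lemma ind_tens_morph x : zmod_morphism (ind_tens x).
Proof. by move=> l m; rewrite /ind_tens scalerBr raddfB. Qed.

Lemma ind_tens_mul x h l : ind_tens (x * iota h)%g l = ind_tens x (gr h *: l).
Proof. by rewrite /ind_tens tau_mul eta_mul gr_scaleM. Qed.

Lemma ind_tens_tr (t : tT X) l : ind_tens (tr t) l = << l *g t >>.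
Proof. by rewrite /ind_tens tau_tr eta_tr gr_scale1. Qed.

Let act (g : G) : ind -> ind := msum (fun t : tT X => ind_tens (g * tr t)%g).
Let actB g : zmod_morphism (act g).
Proof. by apply: msum_morph => t; apply: ind_tens_morph. Qed.
Let act_tens g x l : act g (ind_tens x l) = ind_tens (g * x)%g l.
Proof.
rewrite /act [ind_tens x l]/ind_tens msumU; last by move=> t;
  apply: ind_tens_morph.
by rewrite /= -ind_tens_mul -mulgA -trE.
Qed.
Lemma ind_additive_ext (V : zmodType) (f g : {additive ind -> V}) :
  (forall x l, f (ind_tens x l) = g (ind_tens x l)) -> forall u, f u = g u.
Proof. by move=> fg; apply: malg_additive_ext => t l; rewrite -ind_tens_tr fg.
  Qed.
Let act1 v : act 1%g v = v.
Proof.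
apply: (ind_additive_ext (f := mk_additive (actB 1%g))
  (g := idfun : {additive _ -> _})).
by move=> x l; rewrite mk_additiveE act_tens mul1g.
Qed.
Let actM g h v : act g (act h v) = act (g * h)%g v.
Proof.
apply: (ind_additive_ext
  (f := mk_additive (actB g) \o mk_additive (actB h) : {additive _ -> _})
  (g := mk_additive (actB (g * h)%g))) => x l.
by rewrite /= !act_tens mulgA.
Qed.

HB.instance Definition _ := GRing.Zmodule_isLmodule.Build RG ind
  (ascaleA actB actM) (ascale1 act1) (ascaleDr actB) (ascaleDl act).

Lemma ind_scale g x l : gr g *: ind_tens x l = ind_tens (g * x)%g l.
Proof. by rewrite -act_tens; apply: (ascale_gr act g). Qed.

(** The universal property of induction. *)
Lemma ind_lift (V : lmodType RG) (u : {linear L -> res V}) :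
  exists f : {linear ind -> V}, forall x l,
    f (ind_tens x l) = gr x *: (u l : V).
Proof.
have FB (t : tT X) : zmod_morphism (fun l => gr (tr t) *: (u l : V)).
  by move=> l m; rewrite linearB -scalerBr.
pose f := msum (fun (t : tT X) l => gr (tr t) *: (u l : V)).
have fB : zmod_morphism f by apply: msum_morph.
have fE x l : f (ind_tens x l) = gr x *: (u l : V).
  rewrite /f /ind_tens (msumU FB) linearZ /= res_scale -gr_scaleM.
  by rewrite -trE.
have fL : linear (f : ind -> V).
  apply: equivariant_linear => // g v.
  have scB (W : lmodType RG) : zmod_morphism ( *:%R (gr g) : W -> W).
    by move=> x y; rewrite scalerBr.
  apply: (ind_additive_ext
    (f := mk_additive fB \o mk_additive (scB ind) : {additive _ -> _})
    (g := mk_additive (scB V) \o mk_additive fB : {additive _ -> _})) => x l.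
  by rewrite /= ind_scale !fE gr_scaleM.
by exists (mk_linear fL) => x l; rewrite mk_linearE fE.
Qed.

End Ind.

Lemma ind_tens1_linear (L : lmodType RH) : linear
    (ind_tens 1%g : L -> res (ind L)).
Proof.
apply: equivariant_linear; first exact: ind_tens_morph.
by move=> h l; rewrite res_scale ind_scale mulg1 -ind_tens_mul mul1g.
Qed.

Fact ind_map_linear (L M : lmodType RH) (f : {linear L -> M}) :
  linear (malg_map f : ind L -> ind M).
Proof.
have fE x l : malg_map f (ind_tens x l) = ind_tens x (f l).
  by rewrite /ind_tens malg_mapU /= linearZ.
apply: equivariant_linear => [u v|g u]; first by rewrite raddfB.
have scB (W : lmodType RG) : zmod_morphism ( *:%R (gr g) : W -> W).
  by move=> x y; rewrite scalerBr.
apply: (ind_additive_ext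
  (f := malg_map f \o mk_additive (scB (ind L)) : {additive _ -> ind M})
  (g := mk_additive (scB (ind M)) \o malg_map f : {additive _ -> _})) => x l.
by rewrite /= ind_scale !fE ind_scale.
Qed.

Definition ind_map (L M : lmodType RH) (f : {linear L -> M}) :
  {linear ind L -> ind M} := mk_linear (ind_map_linear f).

Lemma ind_map_coeff (L M : lmodType RH) (f : {linear L -> M}) u t :
  (ind_map f u)@_t = f u@_t.
Proof. exact: malg_mapE. Qed.

Lemma ind_map_tens (L M : lmodType RH) (f : {linear L -> M}) x l :
  ind_map f (ind_tens x l) = ind_tens x (f l).
Proof. by rewrite mk_linearE /ind_tens malg_mapU /= linearZ. Qed.

Lemma ind_ses (A B C : lmodType RH) (i : {linear A -> B}) (p : {linear B -> C})
    :
  ses i p -> ses (ind_map i) (ind_map p).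
Proof.
move=> [i_inj ip_ex p_surj].
have lift (M N : lmodType RH) (f : {linear M -> N}) (u : {malg N[tT X]}) :
    (forall t, exists m, f m = u@_t) -> exists v, ind_map f v = u.
  move=> /choice[s sE]; exists (\sum_(t <- msupp u) << s t *g t >>
    : {malg M[tT X]}).
  rewrite linear_sum [RHS]monalgE; apply/eq_bigr => t _.
  by rewrite mk_linearE malg_mapU /= sE.
split=> [u v uv|u|u].
- apply/malgP => t; apply: i_inj.
  by rewrite -!ind_map_coeff uv.
- split=> [u0|[v <-]]; last first.
    apply/malgP => t; rewrite !ind_map_coeff mcoeff0; apply/ip_ex.
    by eexists.
  by apply: lift => t; apply/ip_ex; rewrite -ind_map_coeff u0 mcoeff0.
by apply: lift => t; apply: p_surj.
Qed.

(** Induction is left adjoint to restriction, which preserves surjections. *)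
Lemma ind_projective (P : lmodType RH) : projective P -> projective (ind P).
Proof.
move=> Pproj A B p f p_surj.
pose p' : {linear res A -> res B} := mk_linear (res_map_linear p).
pose f' : {linear P -> res B} :=
  mk_linear (res_map_linear f) \o mk_linear (ind_tens1_linear (L := P)).
have [u uE] := Pproj _ _ p' f' p_surj; have [g gE] := ind_lift u.
exists g; apply: (ind_additive_ext (f := p \o g : {additive _ -> _}) (g := f))
  => x l.
have uE' : p (u l : A) = f (ind_tens 1%g l) := uE l.
by rewrite /= gE linearZ /= uE' -linearZ ind_scale mulg1.
Qed.

(** A basis of [L] repeated over all cosets. *)
Lemma ind_Z_free (L : lmodType RH) : Z_free L -> Z_free (ind L).
Proof.
move=> [Y [f f_bij]]; exists (Y * tT X : choiceType)%type.
have fB : zmod_morphism (f : {malg int[Y]} -> L) by move=> a b; apply: linearB.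
have fMz w (a : int) : f (w *~ a) = (f w : L) *~ a :> L.
  exact: (raddfMz (mk_additive fB) a w).
have f0 : f 0 = 0 :> L by apply: (raddf0 (mk_additive fB)).
pose F : {linear {malg int[(Y * tT X)%type]} -> zmodule (ind L)} :=
  lin_ext (fun p : (Y * tT X)%type =>
  (<< (f << p.1 >> : L) *g p.2 >> : ind L) : zmodule (ind L)).
pose slice (t : tT X) := lin_ext (fun p : (Y * tT X)%type =>
  if p.2 == t then << p.1 >> else 0 : {malg int[Y]}).
have F_coeff u t : (F u : {malg L[tT X]})@_t = f (slice t u).
  have FcB : zmod_morphism (fun u => (F u : {malg L[tT X]})@_t).
    by move=> a b; rewrite -mcoeffB linearB.
  have fsB : zmod_morphism (fun u => f (slice t u) : L).
    by move=> a b; rewrite /slice linearB fB.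
  apply: (malg_additive_ext (f := mk_additive FcB) (g := mk_additive fsB)) =>
    p a.
  rewrite !mk_additiveE.
  have -> : F << a *g p >> = (<< (f << p.1 >> : L) *g p.2 >> : ind L) *~ a.
    by rewrite /F /= lin_extU scalezrE.
  have -> : slice t << a *g p >> = (if p.2 == t then << p.1 >> else 0) *~ a.
    by rewrite /slice lin_extU -{1}[a]intz scaler_int.
  rewrite fMz (raddfMz (mcoeff t)) /= mcoeffU; congr (_ *~ _).
  case: eqP => _; first by rewrite mulr1n.
  by rewrite mulr0n f0.
have slice_coeff u t y : (slice t u)@_y = u@_(y, t).
  apply: (malg_additive_ext (f := mcoeff y \o slice t : {additive _ -> _})
    (g := mcoeff (y, t) : {additive _ -> _})) => -[z s] a.
  rewrite /slice /= lin_extU mcoeffZ mcoeffU -pair_eqE /= andbC.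
  by case: eqP => _ /=; rewrite ?mcoeffU ?mcoeff0 ?mulr0 ?mulr0n // mulrnAr
    mulr1.
exists F; have F_inj : injective F.
  apply: raddf_inj => u Fu; apply/malgP => -[y t]; rewrite -slice_coeff.
  have : f (slice t u) = 0 by rewrite -F_coeff Fu; apply: mcoeff0.
  move=> fs0; have -> : slice t u = 0 by apply: (bij_inj f_bij);
    rewrite fs0 linear0.
  by rewrite !mcoeff0.
have F_surj : surj F.
  move=> v; have [finv _ fK] := f_bij.
  exists (\sum_(t <- msupp (v : {malg L[tT X]}))
     lin_ext (fun y : Y => << (y, t) >> : {malg int[(Y * tT X)%type]})
       (finv (v : {malg L[tT X]})@_t)).
  rewrite linear_sum [RHS](monalgE (v : {malg L[tT X]})); apply/eq_bigr => t _.
  rewrite -[X in _ = << X *g _ >>]fK; move: (finv _) => w.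
  have gB : zmod_morphism (fun w => << (f w : L) *g t >> : ind L).
    by move=> a b; rewrite fB raddfB.
  apply: (malg_additive_ext (f :=
    F \o lin_ext (fun y : Y => << (y, t) >>) : {additive _ -> ind L})
    (g := mk_additive gB)) => y a.
  rewrite /= lin_extU linearZ /= /F /= lin_extU scale1r.
  rewrite scalezrE -raddfMz /= -fMz; congr (<< f _ *g _ >>).
  by rewrite -raddfMz /= intz.
have [g gE] := choice F_surj; exists g => [u|//].
by apply: F_inj; rewrite gE.
Qed.

End Induced.

(** Shapiro's lemma, for free coefficients: a map to a free [Z[H]]-module is pushed
    into the free [Z[G]]-module on the same basis, extended there from the induced
    module, and pulled back by forgetting the group elements outside [H]. *)
Lemma Ext1_zero_ind (X : transversal) (S : lmodType RH) (K : choiceType) :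
  Ext1_zero (ind X S) {malg RG[K]} -> Ext1_zero S {malg RH[K]}.
Proof.
move=> ext h.
have pushL : linear (malg_map gr_push : {malg RH[K]} -> res {malg RG[K]}).
  apply: equivariant_linear => [x y|g c]; first by rewrite raddfB.
  by rewrite malg_push_equivariant -res_scale.
have pullL : linear (malg_map gr_pull : res {malg RG[K]} -> {malg RH[K]}).
  apply: equivariant_linear => [x y|g c]; first by rewrite raddfB.
  by rewrite -malg_pull_equivariant res_scale.
have [u uE] := ind_lift X (mk_linear pushL \o h
  : {linear _ -> res {malg RG[K]}}).
have [e eE] := Ext1_zero_extend (ind_ses X (ses_syzygy S)) ext u.
exists (mk_linear pullL \o (mk_linear (res_map_linear e) \o
   mk_linear (ind_tens1_linear X (L := {malg RH[S]})))) => z.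
rewrite /= -ind_map_tens eE uE gr_scale1 /=.
by apply/malgP => k; rewrite !malg_mapE gr_pull_push.
Qed.

Lemma Ext1_zero_ind_syzygy (X : transversal) (L : lmodType RH) n
    (F : lmodType RG) :
  Ext1_zero (syzygy (ind X L) n) F -> Ext1_zero (ind X (syzygy L n)) F.
Proof.
elim: n L => //= n IH L ext; rewrite -iterS iterSr; apply: IH.
have Pproj := ind_projective (X := X) (malg_projective (R := RH) (X := L)).
exact/(stable_shift n (Ext1_zero_stable (F := F)) (ind_ses X (ses_syzygy L))
  Pproj).
Qed.

End Restriction.

(** * Torsionless modules: reduction to countable subgroups *)

Section GeneratedSubgroup.
Variables (G : groupType) (T : seq G).

Let letter (bi : bool * nat) : G :=
  if bi.1 then nth 1%g T bi.2 else (nth 1%g T bi.2)^-1%g.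
Let word (w : seq (bool * nat)) : G :=
  foldr (fun bi x => letter bi * x)%g 1%g w.

Definition genp : {pred G} := fun g => `[< exists w, word w = g >].

Let word_cat w v : word (w ++ v) = (word w * word v)%g.
Proof. by elim: w => [|b w IH] /=; rewrite ?mul1g // IH mulgA. Qed.

Fact genp_group_closed : group_closed genp.
Proof.
have inv w : exists v, word v = (word w)^-1%g.
  elim: w => [|b w [v vE]]; first by exists [::]; rewrite /= invg1.
  exists (v ++ [:: (~~ b.1, b.2)]); rewrite word_cat vE /= mulg1 invgM.
  by congr (_ * _)%g; rewrite /letter; case: b => -[] i /=; rewrite ?invgK.
split; first by apply/asboolP; exists [::].
move=> x y /asboolP[w <-] /asboolP[v <-]; apply/asboolP.
by have [v' <-] := inv v; exists (w ++ v'); rewrite word_cat.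
Qed.

Definition gen : Type := {g : G | genp g}.
HB.instance Definition _ := SubChoice.on gen.
HB.instance Definition _ := SubChoice_isSubGroup.Build G genp gen
  genp_group_closed.

Lemma ctbl_gen : ctbl gen.
Proof.
have wP w : genp (word w) by apply/asboolP; exists w.
apply: (ctbl_surj (f := fun w => exist _ (word w) (wP w) : gen)).
  by move=> [g gP]; have [w wE] := asboolP _ gP; exists w; apply: val_inj.
exact: (ctbl_countType [::]).
Qed.

Lemma mem_gen g : g \in T -> exists h : gen, val h = g.
Proof.
move=> gT; have gP : genp g.
  by apply/asboolP; exists [:: (true, index g T)];
    rewrite /= mulg1 /letter nth_index.
by exists (exist _ g gP).
Qed.

Definition gen_val : {multiplicative gen -> G} := val.

End GeneratedSubgroup.

(** An injective map from a module over [H] to one over [G] induces an injective map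
    of syzygies, whose image consists of the elements all of whose ingredients come
    from [H] and [L0]. *)
Section FreeMap.
Variables (H G : groupType) (iota : {multiplicative H -> G}).
Local Notation RH := (group_ring H).
Local Notation RG := (group_ring G).
Hypothesis iota_inj : injective iota.
Variables (L0 : lmodType RH) (L : lmodType RG) (f : {linear L0 -> res iota L}).
Hypothesis f_inj : injective f.

Fact free_map_key : {F : {linear {malg RH[L0]} -> res iota {malg RG[L]}} |
  forall l, F << l >> = << (f l : L) >>}.
Proof.
exists (lin_ext (fun l => << (f l : L) >> : res iota {malg RG[L]})) => l.
by rewrite /= lin_extU scale1r.
Qed.

Let F := sval free_map_key.

Let F_gen l : F << l >> = << (f l : L) >>.
Proof. exact: (svalP free_map_key). Qed.

Let F_genZ l a : F << a *g l >> = << gr_push iota a *g (f l : L) >>.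
Proof.
have -> : << a *g l >> = a *: (<< l >> : {malg RH[L0]}).
  by apply/malgP => k; rewrite mcoeffZ !mcoeffU mulrnAr mulr1.
rewrite linearZ /= F_gen res_scale_push; apply/malgP => k.
by rewrite mcoeffZ !mcoeffU mulrnAr mulr1.
Qed.

Let F_coeff c l : (F c : {malg RG[L]})@_(f l) = gr_push iota c@_l.
Proof.
have cB : zmod_morphism (fun c => (F c : {malg RG[L]})@_(f l)).
  by move=> x y; rewrite linearB mcoeffB.
apply: (malg_additive_ext (f := mk_additive cB)
  (g := gr_push iota \o mcoeff l : {additive _ -> _})) => k a.
rewrite mk_additiveE F_genZ /= !mcoeffU (inj_eq f_inj).
by rewrite -raddfMn.
Qed.

Let F_inj : injective F.
Proof.
move=> x y xy; apply/malgP => l; apply: (gr_push_inj iota_inj).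
by rewrite -!F_coeff xy.
Qed.

Let F_cover c : cover (F c : {malg RG[L]}) = f (cover c) :> L.
Proof.
pose a : {linear {malg RH[L0]} -> res iota L} :=
  mk_linear (res_map_linear (iota := iota)
    (@cover _ L : {linear {malg RG[L]} -> L})) \o F.
pose b : {linear {malg RH[L0]} -> res iota L} := f \o @cover _ L0.
apply: (lin_ext_unique (f := a) (g := b)) => l.
by rewrite /a /b /= F_gen !coverU.
Qed.

Lemma syzygy_map : exists theta : {linear syzygy1 L0 -> res iota (syzygy1 L)},
  [/\ injective theta,
   (forall z l, (sincl L (theta z))@_(f l) = gr_push iota (sincl L0 z)@_l) &
   forall z : syzygy1 L,
     (forall y, y \in msupp (sincl L z) -> exists l, f l = y) ->
     (forall y g, y \in msupp (sincl L z) -> g \in msupp (sincl L z)@_y ->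
        exists h, iota h = g) ->
   exists z0, theta z0 = z].
Proof.
have /choice[theta thE] : forall z, exists w : syzygy1 L,
  sincl L w = F (sincl L0 z).
  by move=> z; apply: cover_ker; rewrite F_cover cover_sincl linear0.
have thL : linear (theta : syzygy1 L0 -> res iota (syzygy1 L)).
  apply: equivariant_linear => [x y|h z]; apply: (@sincl_inj _ L).
    by rewrite linearB !thE !linearB.
  by rewrite res_scale linearZ /= !thE !linearZ /= res_scale.
exists (mk_linear thL); split=> [x y xy|z l|z zf zi].
- apply: (@sincl_inj _ L0); apply: F_inj; rewrite -!thE.
  by rewrite [theta x]xy.
- by rewrite mk_linearE thE F_coeff.
have push_pull (a : RG) : (forall g, g \in msupp a -> exists h, iota h = g) ->
    gr_push iota (gr_pull iota_inj a) = a.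
  move=> ai; rewrite [in RHS](gr_sum a) {1}(gr_sum a) !raddf_sum !big_seq.
  apply/eq_bigr => g ga; rewrite /= !raddfMz /=; have [h <-] := ai g ga.
  by rewrite gr_pullE gr_pushE.
have [c cE] : exists c, F c = sincl L z.
  have /choice[s sE] : forall y, exists l, y \in msupp (sincl L z) -> f l = y.
    move=> y; have [/zf[l lE]|_] := boolP (y \in msupp (sincl L z));
      first by exists l.
    by exists 0.
  exists (\sum_(y <- msupp (sincl L z)) << gr_pull iota_inj (sincl L z)@_y *g s
    y >>).
  rewrite linear_sum [RHS]monalgE !big_seq; apply/eq_bigr => y yz.
  by rewrite /= F_genZ push_pull ?sE // => g; apply: zi.
have [z0 z0E] : exists z0, sincl L0 z0 = c.
  by apply: cover_ker; apply: f_inj; rewrite linear0 -F_cover cE cover_sincl.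
by exists z0; apply: (@sincl_inj _ L); rewrite mk_linearE thE z0E.
Qed.

End FreeMap.

Lemma mem_flatten (A B : eqType) (F : A -> seq B) r (a : A) b :
  a \in r -> b \in F a -> b \in flatten [seq F a | a <- r].
Proof. by move=> ar bF; apply/flatten_mapP; exists a. Qed.

Section SyzygySupport.
Variables (G : groupType) (M : lmodType (group_ring G)).
Implicit Types (z : syzygy1 M) (s : seq (syzygy1 M)).

Definition basis_support z : seq M := enum_fset (msupp (sincl M z)).

Definition letters z : seq G :=
  flatten [seq enum_fset (msupp (sincl M z)@_y) | y <- basis_support z].

Lemma mem_letters z y g :
  y \in msupp (sincl M z) -> g \in msupp (sincl M z)@_y -> g \in letters z.
Proof. by move=> yz gz; apply/flatten_mapP; exists y. Qed.

End SyzygySupport.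

(** By induction on [j].  Finitely many elements of a syzygy involve finitely many
    elements of the previous one and finitely many elements of [G]; they are defined
    over any subgroup and submodule that carry these ingredients, and in degree [0]
    generated ones will do. *)
Lemma countable_support (G : groupType) (L : lmodType (group_ring G)) j
    (S : seq (syzygy L j)) (T : seq G) :
  exists (H : groupType) (iota : {multiplicative H -> G}),
  [/\ injective iota, ctbl H, (forall g, g \in T -> exists h, iota h = g) &
  exists2 L0 : lmodType (group_ring H), ctbl L0 &
  (exists f : {additive L0 -> L}, injective f) /\
  exists2 theta : {linear syzygy L0 j -> res iota (syzygy L j)},
    injective theta &
    forall s, s \in S -> exists s0, theta s0 = s].
Proof.
elim: j S T => [|j IH] S T.
  pose iota := gen_val T; exists (gen T), iota; split;
    [exact: val_inj|exact: ctbl_gen| |].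
    exact: mem_gen.
  pose f : {linear {malg (group_ring (gen T))[nat]} -> res iota L} :=
    lin_ext (fun i : nat => nth (0 : L) S i : res iota L).
  have vL : linear (fun z : limg f => val z : res iota L) by [].
  exists (limg f); last split.
  - apply: (ctbl_surj (f := fun c =>
    exist _ (f c) (introT (asboolP _) (ex_intro _ c erefl)) : limg f)).
      by move=> [x xP]; have [c cE] := asboolP _ xP; exists c; apply: val_inj.
    apply: ctbl_malg; first exact: (ctbl_countType 0%N).
    by apply: ctbl_malg; [exact: ctbl_gen | exact: (ctbl_countType (0 : int))].
  - have vB : zmod_morphism (fun z : limg f => val z : L) by [].
    by exists (mk_additive vB); apply: val_inj.
  exists (mk_linear vL); first exact: val_inj.
  move=> s sS; have sP : limgp f s.
    apply/asboolP; exists << index s S >>.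
    by rewrite /f /= lin_extU scale1r nth_index.
  by exists (exist _ s sP).
pose S' := flatten [seq basis_support s | s <- S].
pose T' := T ++ flatten [seq letters s | s <- S].
have [H [iota [iota_inj cH TH [L0 cL0 [L0L [theta th_inj thS]]]]]] := IH S' T'.
exists H, iota; split=> // [g gT|]; first by apply: TH; rewrite mem_cat gT.
exists L0 => //; split=> //.
have [theta' [th'_inj _ th'P]] := syzygy_map iota_inj th_inj.
exists theta' => // s sS; apply: th'P => [y ys|y g ys gs].
  by apply/thS/(mem_flatten sS).
by apply: TH; rewrite mem_cat (mem_flatten sS) ?orbT // (mem_letters ys).
Qed.

Section RightCoinducedInjective.
Variables (H G : groupType) (iota : {multiplicative H -> G}) (W : zmodType).
Hypotheses (iota_inj : injective iota) (W_div : divisible W).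

(** A map into a coinduced module is determined by additive maps to [W], one for
    each coset representative, and these extend because [W] is divisible. *)
Lemma rcoind_injective : injective_module (rcoind iota W).
Proof.
have [X] := transversal_exists iota_inj; move=> A B f g f_inj.
have gB (x : G) : zmod_morphism (fun a => g a x) by move=> a b; rewrite linearB.
have /choice[e eE] : forall t : tT X, exists e : {additive B -> W},
    forall a, e (f a) = g a (tr t)^-1%g.
  by move=> t; apply: (divisible_extend (mk_additive (gB (tr t)^-1%g)) f_inj
    W_div).
pose h (b : B) : rcoind iota W := fun x =>
  e (tau X x^-1%g) ((gr (eta X x^-1%g)^-1%g : (group_ring H)^c) *: b).
have grA (V : lmodType (group_ring H)^c) (k l : H) (v : V) :
    (gr k : (group_ring H)^c) *: ((gr l : (group_ring H)^c) *: v) =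
    (gr (l * k)%g : (group_ring H)^c) *: v.
  by rewrite scalerA grM.
have hL : linear h.
  apply: equivariant_linear_r => [a b|k b]; apply/funext => x.
    by rewrite /h scalerBr raddfB.
  rewrite rcoind_scale /h grA invgM -iotaV tau_mul eta_mul.
  by rewrite invgM invgK.
exists (mk_linear hL) => a; apply/funext => x; rewrite mk_linearE /h.
rewrite -linearZ eE linearZ /= rcoind_scale; congr (g a _).
apply: invg_inj; rewrite invgM invgK -iotaV invgK.
by rewrite [RHS](trE X).
Qed.

End RightCoinducedInjective.

Lemma rcoind_scale_push (H G : groupType) (iota : {multiplicative H -> G})
    (W : zmodType) (r : group_ring H) (f : G -> W) :
  (r : (group_ring H)^c) *: (f : rcoind iota W) =
  (gr_push iota r : (group_ring G)^c) *: (f : rcoind idfun W) :> (G -> W).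
Proof.
have sH : zmod_morphism (fun r : group_ring H =>
    (r : (group_ring H)^c) *: (f : rcoind iota W) : G -> W).
  by move=> x y; rewrite scalerBl.
have sG : zmod_morphism (fun r : group_ring G =>
    (r : (group_ring G)^c) *: (f : rcoind idfun W) : G -> W).
  by move=> x y; rewrite scalerBl.
apply: (gr_additive_ext (f := mk_additive sH)
  (g := mk_additive sG \o gr_push iota : {additive _ -> _})) => h.
rewrite /= gr_pushE; apply/funext => x.
by rewrite rcoind_scale (rcoind_scale (iota := idfun)).
Qed.

Definition Ext_bound (G : groupType) (n : nat) : Prop :=
  forall (L F : lmodType (group_ring G)) j, Z_free L -> free_module F ->
  (n <= j)%N -> Ext1_zero (syzygy L j) F.

Lemma free_module_malg (R : nzRingType) (K : choiceType) : free_module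
    {malg R[K]}.
Proof. by exists K, (idfun : {linear {malg R[K]} -> {malg R[K]}}), idfun. Qed.

Lemma ctbl_syzygy (R : nzRingType) (L : lmodType R) j :
  ctbl R -> ctbl L -> ctbl (syzygy L j).
Proof.
move=> cR cL; elim: j => //= j IH.
by apply: (ctbl_sub (0 : lker (@cover R (syzygy L j)))); apply: ctbl_malg.
Qed.

Section TorsionlessTor.
Variables (G : groupType) (n : nat) (W : zmodType).
Hypotheses (extG : Ext_bound G n) (W_div : divisible W).
Local Notation R := (group_ring G).

Lemma subgroup_Ext (H : groupType) (iota : {multiplicative H -> G})
    (L : lmodType (group_ring H)) (K : choiceType) j :
  injective iota -> Z_free L -> (n <= j)%N ->
  Ext1_zero (syzygy L j) {malg (group_ring H)[K]}.
Proof.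
move=> iota_inj L_free nj; have [X] := transversal_exists iota_inj.
apply: (Ext1_zero_ind iota_inj (X := X)); apply: Ext1_zero_ind_syzygy.
by apply: extG => //; [apply: ind_Z_free | apply: free_module_malg].
Qed.

(** A class in [Tor] is carried by finitely many elements of a syzygy.  These come
    from a countable torsionless, hence [Z]-free, module over a countable subgroup
    [H], where the class already vanishes. *)
Lemma torsionless_Tor (L : lmodType R) j : torsionless L -> (n <= j)%N ->
  Tor1_zero (rcoind idfun W : lmodType R^c) (syzygy L j).
Proof.
move=> tL nj t t0; have [s tE] := tensorP t.
pose M := syzygy L j.
pose S := flatten [seq basis_support p.2 | p <- s].
pose T := flatten [seq letters p.2 | p <- s].
have [H [iota [iota_inj cH TH [L0 cL0 [[L0L L0L_inj] [theta th_inj thS]]]]]] :=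
  countable_support S T.
have cR : ctbl (group_ring H) by apply: ctbl_malg => //;
  exact: (ctbl_countType (0 : int)).
have L0_free : Z_free L0.
  exact/(countable_torsionless_free cL0)/(torsionless_sub L0L_inj).
have [theta' [th'_inj th'_coeff th'P]] := syzygy_map iota_inj th_inj.
have /choice[k kE] : forall p, exists k0, p \in s ->
  theta' k0 = p.2 :> syzygy1 M.
  move=> p; have [ps|_] := boolP (p \in s); last by exists 0.
  have [|y g yp gp|k0 k0E] := th'P p.2; last by exists k0.
    by move=> y yp; apply: thS; apply:
      (mem_flatten (F := fun p => basis_support p.2) ps).
  apply: TH; apply: (mem_flatten (F := fun p => letters p.2) ps).
  exact: (mem_letters yp).
pose IH : lmodType (group_ring H)^c := rcoind iota W.
pose M0 := syzygy L0 j.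
pose t' : tensor IH (syzygy1 M0) := \sum_(p <- s) tens (p.1 : IH) (k p).
have t'0 : t' = 0.
  have ext_form (h : {linear syzygy1 M0 -> (group_ring H)^o}) :
      exists e : {linear {malg (group_ring H)[M0]} -> (group_ring H)^o},
      forall z, e (sincl M0 z) = h z.
    have uL : linear (fun a : (group_ring H)^o =>
      << a *g 0%N >> : {malg (group_ring H)[nat]}).
      move=> a x y; apply/malgP => i; rewrite mcoeffD mcoeffZ !mcoeffU.
      by case: eqP => _; rewrite ?mulr1n // !mulr0n mulr0 addr0.
    have [e eE] := subgroup_Ext (K := nat) iota_inj L0_free nj
      (mk_linear uL \o h : {linear _ -> _}).
    exists (mcoeff_lin 0%N \o e) => z.
    by rewrite /= eE /= mcoeffUU.
  apply: (countable_Tor_injective (i := sincl M0)) => //.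
  - exact: (ctbl_syzygy (L := L0) j.+1).
  - exact: rcoind_injective.
  - exact: (subgroup_Ext (j := j.+1) iota_inj L0_free (leqW nj)).
  apply: tensor_free_eq0 => l.
  have := congr1 (contract (mcoeff_lin (theta l : M))) t0.
  rewrite tE !tensor_map_sum !contract_sum raddf0 => E.
  apply: etrans E; rewrite !big_seq.
  apply: (big_ind2 (fun (x y : G -> W) => x = y)) => //.
    by move=> x1 x2 y1 y2 -> ->.
  move=> p ps; rewrite !mcoeff_linE.
  by rewrite rcoind_scale_push -th'_coeff kE.
have [phi phiE] : exists phi : {additive tensor IH (syzygy1 M0) ->
    tensor (rcoind idfun W : lmodType R^c) (syzygy1 M)},
    forall x m, phi (tens x m) = tens (x : rcoind idfun W)
      (theta' m : syzygy1 M).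
  apply: (tensor_lift (b := fun (x : IH) m =>
    tens (x : rcoind idfun W : lmodType R^c) (theta' m : syzygy1 M))).
  - by move=> x x' m; rewrite -tensDl.
  - by move=> x m m'; rewrite linearD -tensDr.
  - move=> x r m; rewrite linearZ /= res_scale_push -tensZ.
    exact: (congr1 (fun u : G -> W =>
      tens (u : rcoind idfun W : lmodType R^c) _)
      (rcoind_scale_push iota r x)).
rewrite tE; transitivity (phi t'); last by rewrite t'0 raddf0.
rewrite /t' raddf_sum /= !big_seq; apply/eq_bigr => p ps.
by rewrite phiE kE.
Qed.

End TorsionlessTor.

(** * Rational coefficients *)

Section LinearCokernel.
Variables (R : nzRingType) (A B : lmodType R) (f : {linear A -> B}).

Definition lcoker : Type := @Quotient.quot B (limgp f).
HB.instance Definition _ := GRing.Zmodule.on lcoker.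

Let pi (b : B) : lcoker := \pi_(@Quotient.quot B (limgp f))%qT b.

Let piB : zmod_morphism pi.
Proof. by move=> x y; apply: (raddfB \pi_(@Quotient.quot B (limgp f))%qT). Qed.

Let pi_eq x y : pi x = pi y <-> exists a, f a = x - y.
Proof.
rewrite /pi; split=> [/eqP|fE].
  by rewrite -Quotient.idealrBE => /asboolP.
by apply/eqP; rewrite -Quotient.idealrBE; apply/asboolP.
Qed.

Let piK (c : lcoker) : pi (repr c) = c.
Proof. exact: reprK. Qed.

Let sc (r : R) (c : lcoker) : lcoker := pi (r *: repr c).

Let sc_pi r b : sc r (pi b) = pi (r *: b).
Proof.
apply/pi_eq; have [a aE] := (pi_eq _ _).1 (piK (pi b)).
by exists (r *: a); rewrite linearZ /= aE scalerBr.
Qed.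

Let scA a b v : sc a (sc b v) = sc (a * b) v.
Proof. by rewrite -[v]piK !sc_pi scalerA. Qed.
Let sc1 v : sc 1 v = v.
Proof. by rewrite -[v]piK sc_pi scale1r. Qed.
Let piD x y : pi (x + y) = pi x + pi y.
Proof. exact: (raddfD (mk_additive piB)). Qed.
Let scDr a u v : sc a (u + v) = sc a u + sc a v.
Proof. by rewrite -[u]piK -[v]piK -piD !sc_pi scalerDr piD. Qed.
Let scDl v a b : sc (a + b) v = sc a v + sc b v.
Proof. by rewrite -[v]piK !sc_pi scalerDl piD. Qed.

HB.instance Definition _ := GRing.Zmodule_isLmodule.Build R lcoker scA sc1 scDr
  scDl.

Lemma lcoker_proj : exists p : {linear B -> lcoker},
  surj p /\ forall b, p b = 0 <-> exists a, f a = b.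
Proof.
have pL : linear pi by move=> r x y; rewrite piD -sc_pi.
exists (mk_linear pL); split=> [c|b]; first by exists (repr c); apply: piK.
have <- : pi 0 = 0 by apply: (raddf0 (mk_additive piB)).
by rewrite mk_linearE; split=> [/pi_eq|[a aE]];
   [rewrite subr0 | apply/pi_eq; exists a; rewrite subr0].
Qed.

End LinearCokernel.

Lemma divisible_rat : divisible rat.
Proof.
move=> n q n_gt0; exists (q / n%:R); rewrite -[LHS]mulr_natr divfK //.
by rewrite pnatr_eq0 -lt0n.
Qed.

Lemma divisible_fun (T : Type) (W : zmodType) : divisible W ->
    divisible (T -> W).
Proof.
move=> W_div n f n_gt0; have [g gE] := choice (fun x => W_div n (f x) n_gt0).
exists g; apply/funext => x; rewrite -gE.
by elim: (n) => [|m IH]; rewrite ?mulr0n // !mulrS -IH.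
Qed.

Lemma divisible_surj (V W : zmodType) (f : {additive V -> W}) :
  surj f -> divisible V -> divisible W.
Proof.
move=> f_surj V_div n w n_gt0; have [v <-] := f_surj w.
by have [u <-] := V_div n v n_gt0; exists (f u); rewrite raddfMn.
Qed.

Lemma rat_mod_int : exists (W : zmodType) (p : {additive rat -> W}),
  surj p /\ forall q, p q = 0 <-> exists k : int, k%:~R = q.
Proof.
have iL : linear (fun k : zmodule int => k%:~R : zmodule rat).
  move=> a x y; rewrite rmorphD /=; congr (_ + _).
  by rewrite !scalezrE -[x *~ a]mulrzr intz mulrzA.
have [p [p_surj pE]] := lcoker_proj (mk_linear iL).
have pB : zmod_morphism (p : rat -> _) by move=> x y; apply: linearB.
by exists (lcoker (mk_linear iL)), (mk_additive pB); split=> // q;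
  rewrite mk_additiveE.
Qed.

Section CoindMap.
Variables (G : groupType) (A B : zmodType) (f : {additive A -> B}).

Fact coind_map_linear :
  linear (fun u : coind G A => (fun x => f (u x)) : coind G B).
Proof.
apply: equivariant_linear => [u v|g u]; apply/funext => x.
  by rewrite -[RHS]/(f (u x) - f (v x)) -raddfB.
by rewrite !coind_scale.
Qed.

Definition coind_map : {linear coind G A -> coind G B} :=
  mk_linear coind_map_linear.

End CoindMap.

Section RationalDuality.
Variables (G : groupType) (W : zmodType).
Local Notation R := (group_ring G).
Local Notation Q := (triv G rat).
Local Notation I := (rcoind (idfun : {multiplicative G -> G}) W : lmodType R^c).
Local Notation J := (coind G W).

Let right_left g (f : G -> W) :
  ((gr g : R^c) *: (f : I) : G -> W) = (gr g^-1%g *: (f : J) : G -> W).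
Proof. by apply/funext => x; rewrite rcoind_scale coind_scale invgK. Qed.

(** [Hom (J, Q)] is the rational dual of the right module [I], so that maps
    into it are rational functionals on a tensor product. *)
Lemma functional_of_map (M : lmodType R) (h : {linear M -> zhom J Q}) :
  exists chi : {additive tensor I M -> rat}, forall f m,
    chi (tens f m) = zapp (h m) f.
Proof.
apply: (tensor_lift (I := I) (V := rat) (b := fun f m => zapp (h m) f)) =>
  [f f' m|f m m'|f r m].
- exact: (zappD (h m) (f : J) f').
- by rewrite linearD.
have lB : zmod_morphism (fun a : R => zapp (h m) ((a : R^c) *: (f : I)) : rat).
  by move=> a b; rewrite scalerBl; apply: (zappB (h m)).
have rB : zmod_morphism (fun a : R => zapp (h (a *: m)) f : rat).
  by move=> a b; rewrite scalerBl linearB zappBl.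
apply: (gr_additive_ext (f := mk_additive lB) (g := mk_additive rB)) => g.
rewrite !mk_additiveE linearZ /= zhom_scale triv_scale.
exact: (congr1 (zapp (h m)) (right_left g f)).
Qed.

Lemma map_of_functional (M : lmodType R) (chi : {additive tensor I M -> rat}) :
  exists h : {linear M -> zhom J Q}, forall m f,
    zapp (h m) f = chi (tens (f : I) m).
Proof.
have fB m : zmod_morphism (fun f : J => chi (tens (f : I) m) : Q).
  move=> f f'; transitivity (chi (tens ((f : I) - (f' : I)) m)); first by [].
  by rewrite tensDl tensNl raddfB.
have hL : linear (fun m => mk_zhom (fB m)).
  apply: equivariant_linear => [m m'|g m]; apply: zhom_ext => f.
    have tB : tens (f : I) (m - m') = tens (f : I) m - tens (f : I) m'.
      by apply/eqP; rewrite eq_sym subr_eq -tensDr subrK.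
    by rewrite zappBl !mk_zhomE tB raddfB.
  rewrite zhom_scale triv_scale; transitivity
    (chi (tens ((gr g : R^c) *: (f : I)) m)).
    by rewrite tensZ.
  exact: (congr1 (fun u : G -> W => chi (tens (u : I) m)) (right_left g f)).
by exists (mk_linear hL).
Qed.

Lemma Tor_zero_Ext_dual (M : lmodType R) :
  Tor1_zero I M -> Ext1_zero M (zhom J Q).
Proof.
move=> tor h; have [chi chiE] := functional_of_map h.
have inj : injective (tensor_map (I := I) (sincl M)) by apply: raddf_inj.
have [psi psiE] := divisible_extend chi inj divisible_rat.
have [e eE] := map_of_functional psi; exists e => z; apply: zhom_ext => f.
by rewrite eE -tensor_mapE psiE chiE.
Qed.

(** Rational functionals detect the elements of infinite order. *)
Lemma Ext_dual_Tor_torsion (M : lmodType R) : Ext1_zero M (zhom J Q) ->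
  forall t : tensor I (syzygy1 M), tensor_map (sincl M) t = 0 ->
  exists2 m, (0 < m)%N & t *+ m = 0.
Proof.
move=> ext t t0; apply: contrapT => nt.
have iB : zmod_morphism (fun k : int => t *~ k) by move=> k l; rewrite mulrzBr.
have qB : zmod_morphism (fun k : int => k%:~R : rat) by move=> k l;
  rewrite rmorphB.
have i_inj : injective (mk_additive iB).
  apply: raddf_inj => k; rewrite mk_additiveE => tk.
  have [//|k_neq0] := eqVneq k 0; case: nt; exists `|k|%N;
    first by rewrite absz_gt0.
  case: k tk {k_neq0} => n; rewrite ?NegzE ?mulrNz // => /eqP.
  by rewrite oppr_eq0 => /eqP.
have [chi chiE] := divisible_extend (mk_additive qB) i_inj divisible_rat.
have [h hE] := map_of_functional chi; have [e eE] := ext h.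
have [psi psiE] := functional_of_map e.
have : chi t = psi (tensor_map (sincl M) t).
  apply: (tensor_ext (g := psi \o tensor_map (sincl M) : {additive _ -> _})) =>
    f z.
  by rewrite /= tensor_mapE psiE eE hE.
by rewrite t0 raddf0 => chit; have := chiE 1; rewrite !mk_additiveE mulr1z chit.
Qed.

End RationalDuality.

Section FiniteExtBound.
Variables (G : groupType) (n : nat).
Hypothesis extG : Ext_bound G n.
Local Notation R := (group_ring G).
Local Notation Q := (triv G rat).
Local Notation Lambda := (coind G int).

Let rat_tf (m : nat) (b : Q) : (0 < m)%N -> b *+ m = 0 -> b = 0.
Proof.
move=> m_gt0 /eqP; rewrite -[b *+ m]/((b : rat) *+ m) -mulr_natr mulf_eq0.
by rewrite pnatr_eq0 (gtn_eqF m_gt0) orbF => /eqP.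
Qed.

Let zhom_rat_divisible (A : lmodType R) : divisible (zhom A Q).
Proof. by apply: zhom_divisible; [apply: divisible_rat | apply: rat_tf]. Qed.

Lemma torsionless_Ext (W : zmodType) (L : lmodType R) j : divisible W ->
  torsionless L -> (n <= j)%N -> Ext1_zero (syzygy L j) (zhom (coind G W) Q).
Proof. by move=> W_div tL nj; apply/Tor_zero_Ext_dual/(torsionless_Tor extG).
  Qed.

Lemma torsionless_group_ring : torsionless R.
Proof. exact: torsionless_malg torsionless_int. Qed.

Lemma torsionless_syzygy (M : lmodType R) : torsionless (syzygy1 M).
Proof.
apply: (torsionless_sub (@sincl_inj _ M)).
exact: torsionless_malg torsionless_group_ring.
Qed.

Lemma torsionless_Lambda : torsionless Lambda.
Proof.
move=> f f0; have [x fx] : exists x, f x != 0.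
  apply: contrapT => nx; move/eqP: f0; apply; apply/funext => x; apply/eqP.
  by apply: contrapT => /negP fx; apply: nx; exists x.
have eB : zmod_morphism (fun f : Lambda => f x) by [].
by exists (mk_additive eB).
Qed.

(** By balance this concerns [Ext^(n+2) (C, Hom (Lambda, Q))].  As [Lambda] is the
    kernel of [Q^G -> (Q/Z)^G], its dual is the quotient of the duals of these two
    coinduced modules, to which the torsionless case applies since the first syzygy
    of [C] is torsionless. *)
Lemma Lambda_Ext (C : lmodType R) :
  Ext1_zero (syzygy Lambda n.+1) (zhom C Q).
Proof.
apply: Ext1_zhom_balance; first exact: divisible_rat.
have [W [p [p_surj pE]]] := rat_mod_int.
have iB : zmod_morphism (fun k : int => k%:~R : rat) by move=> k l;
  rewrite rmorphB.
have ip : ses (coind_map G (mk_additive iB)) (coind_map G p).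
  split=> [u v uv|u|w].
  - apply/funext => x; have := congr1 (fun f : coind G rat => f x) uv.
    by rewrite !mk_linearE !mk_additiveE => /intr_inj.
  - split=> [u0|[v <-]]; last first.
      by apply/funext => x; rewrite mk_linearE; apply/pE; exists (v x).
    have /choice[v vE] : forall x, exists k : int, k%:~R = u x.
      by move=> x; apply/pE; rewrite -[0]/((0 : coind G W) x) -u0.
    by exists v; apply/funext => x; rewrite mk_linearE mk_additiveE vE.
  have [u uE] := choice (fun x => p_surj (w x)).
  by exists u; apply/funext => x; rewrite mk_linearE uE.
have shift m : syzygy C m.+1 = syzygy (syzygy1 C) m by rewrite /syzygy iterSr.
apply: (Ext1_zero_quotient (zhom_ses (B := Q) divisible_rat ip)).
  rewrite shift; apply: torsionless_Ext => //; first exact: divisible_rat.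
  exact: torsionless_syzygy.
rewrite -[syzygy1 _]/(syzygy C n.+2) shift; apply: torsionless_Ext => //.
  exact: (divisible_surj p_surj divisible_rat).
exact: torsionless_syzygy.
Qed.

(** The dual [Hom (M, Hom (I, Q))] of [M (x) I] is a quotient of the dual of a
    coinduced module [J] to which [M (x) I] maps by [e], with kernel the dual of
    the cokernel [C] of [e]; and [Ext^(n+1) (Lambda, -)] vanishes on the dual of
    [J] while [Ext^(n+2) (Lambda, -)] vanishes on that of [C]. *)
Lemma Lambda_Ext_bilinear (M I : lmodType R) :
  Ext1_zero (syzygy Lambda n) (zhom M (zhom I Q)).
Proof.
pose D := zhom M (zhom I Q); pose J : lmodType R := coind G (D -> rat).
pose e (m : M) (f : I) : J :=
  fun x d => zapp (zapp d (gr x^-1%g *: m)) (gr x^-1%g *: f).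
have e_act g m f : gr g *: e m f = e (gr g *: m) (gr g *: f).
  apply/funext => x; rewrite coind_scale; apply/funext => d; rewrite /e.
  have -> : (g^-1 * x)^-1%g = (x^-1 * g)%g by rewrite invgM invgK.
  by rewrite (gr_scaleM x^-1%g g m) (gr_scaleM x^-1%g g f).
pose span : {linear {malg R[(M * I)%type]} -> J} :=
  lin_ext (fun p => e p.1 p.2).
have [p [p_surj pE]] := lcoker_proj span.
have evB1 (psi : zhom J Q) m : zmod_morphism (fun f => zapp psi (e m f) : Q).
  move=> f f'; rewrite -zappB; congr (zapp _ _).
  by apply/funext => x; apply/funext => d; rewrite /e scalerBr zappB.
have evB2 (psi : zhom J Q) : zmod_morphism (fun m => mk_zhom (evB1 psi m)).
  move=> m m'; apply: zhom_ext => f; rewrite zappBl !mk_zhomE -zappB.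
  congr (zapp _ _); apply/funext => x; apply/funext => d.
  by rewrite /e scalerBr zappB.
have evL : linear (fun psi : zhom J Q => mk_zhom (evB2 psi)).
  apply: equivariant_linear => [psi psi'|g psi].
    by apply: zhom_ext => m; apply: zhom_ext.
  apply: zhom_ext => m; apply: zhom_ext => f.
  by rewrite !mk_zhomE !zhom_scale !mk_zhomE !triv_scale e_act.
pose ev := mk_linear evL.
have evE (psi : zhom J Q) m f : zapp (zapp (ev psi) m) f = zapp psi (e m f)
  by [].
have pev : ses (zpre Q p) ev.
  split=> [chi chi' E|psi|d].
  - apply: zhom_ext => c; have [j <-] := p_surj c.
    by rewrite -!zpreE E.
  - split=> [psi0|[chi <-]]; last first.
      apply: zhom_ext => m; apply: zhom_ext => f.
      rewrite evE zpreE (_ : p (e m f) = 0) ?zapp0 //; apply/pE.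
      by exists << (m, f) >>; rewrite /span /= lin_extU scale1r.
    have psi_e m f : zapp psi (e m f) = 0 by rewrite -evE psi0.
    have psi_span c : zapp psi (span c) = 0.
      rewrite /span /= /lin_ext -[zapp psi]/(mk_additive (zappB psi) : _ -> _)
        raddf_sum.
      rewrite big1 // => q _; rewrite gr_scaleE raddf_sum big1 // => g _.
      by rewrite raddfMz /= e_act psi_e mul0rz.
    have [s sE] := choice p_surj.
    have psi_eq j j' : p j = p j' -> zapp psi j = zapp psi j'.
      move=> pj; have [|c cE] := (pE (j - j')).1;
        first by rewrite linearB pj subrr.
      by apply/eqP; rewrite -subr_eq0 -zappB -cE psi_span.
    have chiB : zmod_morphism (fun c => zapp psi (s c)).
      by move=> c c'; rewrite -zappB; apply: psi_eq; rewrite linearB !sE.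
    exists (mk_zhom chiB); apply: zhom_ext => j; rewrite zpreE mk_zhomE.
    by apply: psi_eq; rewrite sE.
  (* [J] has been chosen so that evaluation at [1] and [d] recovers [d]. *)
  have dB : zmod_morphism (fun j : J => j 1%g d : Q) by [].
  exists (mk_zhom dB); apply: zhom_ext => m; apply: zhom_ext => f.
  by rewrite evE mk_zhomE /e invg1 !gr_scale1.
apply: (Ext1_zero_quotient pev); last exact: Lambda_Ext.
apply: torsionless_Ext => //; last exact: torsionless_Lambda.
by apply: divisible_fun; apply: divisible_rat.
Qed.

(** A coinduced module [W^G] is a module over the ring [Lambda], so that its dual
    is a retract of [Hom (Lambda, Hom (W^G, Q))]. *)
Lemma rational_Ext (W : zmodType) (M : lmodType R) :
  Ext1_zero (syzygy M n) (zhom (coind G W) Q).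
Proof.
pose J : lmodType R := coind G W; pose B : lmodType R := zhom J Q.
pose mulL (l : Lambda) (f : J) : J := fun x => f x *~ l x.
have mulB1 l : zmod_morphism (mulL l).
  by move=> f f'; apply/funext => x;
    rewrite -[RHS]/(f x *~ l x - f' x *~ l x) -mulrzBl.
have mulB2 f : zmod_morphism (mulL ^~ f).
  by move=> l l'; apply/funext => x;
    rewrite -[RHS]/(f x *~ l x - f x *~ l' x) -mulrzBr.
have mul_act g l f : gr g *: mulL l f = mulL (gr g *: l) (gr g *: f).
  by apply/funext => x; rewrite /mulL !coind_scale.
have rB1 (phi : B) l : zmod_morphism (fun f => zapp phi (mulL l f)).
  by move=> f f'; rewrite mulB1 zappB.
have rB2 (phi : B) : zmod_morphism (fun l => mk_zhom (rB1 phi l)).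
  by move=> l l'; apply: zhom_ext => f;
    rewrite zappBl !mk_zhomE (mulB2 f) zappB.
have rL : linear (fun phi : B => mk_zhom (rB2 phi)).
  apply: equivariant_linear => [phi phi'|g phi]; apply: zhom_ext => l;
    apply: zhom_ext => f //.
  by rewrite !mk_zhomE !zhom_scale !mk_zhomE !triv_scale mul_act.
pose one : Lambda := fun _ => 1.
have one_act g : gr g *: one = one by apply/funext => x; rewrite coind_scale.
have vL : linear (fun h : zhom Lambda B => zapp h one).
  apply: equivariant_linear => // g h.
  by rewrite zhom_scale one_act.
apply: (Ext1_zero_retract (s := mk_linear rL) (r := mk_linear vL)).
  move=> phi; apply: zhom_ext => f; rewrite !mk_linearE !mk_zhomE.
  by congr (zapp _ _); apply/funext => x; rewrite /mulL mulr1z.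
by apply: Ext1_zhom_balance; [apply: zhom_rat_divisible |
  apply: Lambda_Ext_bilinear].
Qed.

End FiniteExtBound.

(** * Torsion in [Tor] *)

Section DivisibleImage.
Variables (R : nzRingType) (m : nat).

Section Def.
Variable M : lmodType R.

Definition preim_mulp : {pred {malg R[M]}} := fun c =>
  `[< exists u, cover c = u *+ m :> M >].

Fact preim_mulp_submod_closed : submod_closed preim_mulp.
Proof.
split; first by apply/asboolP; exists 0; rewrite linear0 mul0rn.
move=> k x y /asboolP[u xu] /asboolP[v yv]; apply/asboolP.
by exists (k *: u + v); rewrite linearP /= xu yv mulrnDl scalerMnr.
Qed.

HB.instance Definition _ :=
  GRing.isSubmodClosed.Build R {malg R[M]} preim_mulp preim_mulp_submod_closed.

(** The kernel of [R^(M) -> M / m M]. *)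
Definition preim_mul : Type := {c : {malg R[M]} | preim_mulp c}.

HB.instance Definition _ := SubChoice.on preim_mul.
HB.instance Definition _ := [SubChoice_isSubLmodule of preim_mul by <:].

Definition preim_val : {linear preim_mul -> {malg R[M]}} :=
  @mk_linear R preim_mul {malg R[M]} (fun z => val z) (fun a z w => erefl).

Lemma preim_valP (z : preim_mul) : exists u, cover (preim_val z) = u *+ m :> M.
Proof. exact/asboolP/(valP z). Qed.

Lemma preim_mul_intro (c : {malg R[M]}) (u : M) : cover c = u *+ m ->
  exists z, preim_val z = c.
Proof. by move=> cu; exists (exist _ c (introT (asboolP _) (ex_intro _ u cu))).
  Qed.

Lemma preim_val_inj : injective preim_val.
Proof. exact: val_inj. Qed.

End Def.

Arguments preim_val {M}.

Hypothesis m_gt0 : (0 < m)%N.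

Lemma tf_mul_inj (M : zmodType) (x y : M) : Z_torsion_free M ->
    x *+ m = y *+ m -> x = y.
Proof.
move=> tf xy; apply/eqP; rewrite -subr_eq0; apply/eqP.
have [||//] := tf m (x - y); first by rewrite mulrnBl xy subrr.
by move=> m0; move: m_gt0; rewrite m0.
Qed.

Lemma projective_prod (P Q : lmodType R) :
  projective P -> projective Q -> projective (P * Q)%type.
Proof.
move=> Pp Qp A B p f p_surj.
have f1L : linear (fun x : P => f (x, 0)).
  move=> k x y; rewrite -linearP; congr (f (_, _)).
  by rewrite -[RHS]/(k *: 0 + 0) scaler0 addr0.
have f2L : linear (fun x : Q => f (0, x)).
  move=> k x y; rewrite -linearP; congr (f (_, _)).
  by rewrite -[RHS]/(k *: 0 + 0) scaler0 addr0.
have [g1 g1E] := Pp _ _ p (mk_linear f1L) p_surj.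
have [g2 g2E] := Qp _ _ p (mk_linear f2L) p_surj.
have gL : linear (fun x : P * Q => g1 x.1 + g2 x.2).
  by move=> k x y; rewrite /= !linearP scalerDr addrACA.
exists (mk_linear gL) => -[x y]; rewrite mk_linearE linearD g1E g2E !mk_linearE.
by rewrite -linearD; congr (f (_, _)); rewrite ?addr0 ?add0r.
Qed.

(** The kernels of [R^(M) -> M / m M] for [M] and for its syzygy are related by a
    free presentation [(q, c) |-> d q + m c]: if [d q = - m c] then [c] lies in the
    syzygy, as [M] has no torsion, and it is determined by [q]. *)
Lemma preim_mul_shift (M : lmodType R) :
  Z_torsion_free M -> Z_torsion_free (syzygy1 M) ->
  exists (i : {linear preim_mul (syzygy1 M) ->
    ({malg R[syzygy1 M]} * {malg R[M]})%type})
    (p : {linear ({malg R[syzygy1 M]} * {malg R[M]})%type -> preim_mul M}),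
      ses i p.
Proof.
move=> tfM tfS.
have [u uE] := choice (@preim_valP (syzygy1 M)).
have uL : linear u.
  by move=> k x y; apply: (tf_mul_inj tfS);
    rewrite -uE !linearP /= !uE mulrnDl scalerMnr.
have iL : linear (fun z : preim_mul (syzygy1 M) =>
    (preim_val z, - sincl M (u z)) : ({malg R[syzygy1 M]} * {malg R[M]})%type).
  move=> k x y; congr (_, _).
  by rewrite /= uL linearP opprD scalerN.
have /choice[p pE] : forall c : ({malg R[syzygy1 M]} * {malg R[M]})%type,
    exists z : preim_mul M, preim_val z = sincl M (cover c.1) + c.2 *+ m.
  move=> c; apply: (preim_mul_intro (u := cover c.2)).
  by rewrite linearD linearMn /= cover_sincl add0r.
have pL : linear p.
  move=> k x y; apply: preim_val_inj; rewrite linearP !pE /= !linearP /=.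
  by rewrite mulrnDl scalerDr scalerMnr addrACA.
exists (mk_linear iL), (mk_linear pL); split.
- by move=> x y [xy _]; apply: val_inj.
- move=> [q c]; split=> [pqc|[z <-]]; last first.
    apply: preim_val_inj; rewrite !mk_linearE pE linear0 /= uE.
    by rewrite linearMn mulNrn subrr.
  have E : sincl M (cover q) + c *+ m = 0 by rewrite -(pE (q, c)) [p _]pqc
    linear0.
  have [z zE] : exists z, sincl M z = c.
    apply: cover_ker; apply: (tf_mul_inj tfM); rewrite mul0rn -linearMn.
    have -> : c *+ m = - sincl M (cover q) by apply/eqP;
      rewrite -addr_eq0 addrC E.
    by rewrite linearN /= cover_sincl oppr0.
  have qz : cover q = (- z) *+ m.
    apply: (@sincl_inj _ M); rewrite linearMn linearN /= zE mulNrn.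
    by apply/eqP; rewrite -addr_eq0 E.
  have [w wE] := preim_mul_intro qz; exists w; rewrite mk_linearE wE.
  congr (_, _); suff -> : u w = - z by rewrite linearN opprK zE.
  by apply: (tf_mul_inj tfS); rewrite -uE wE.
move=> z; have [x xE] := preim_valP z.
have [w wE] : exists w, sincl M w = preim_val z - (<< x >> : {malg R[M]}) *+ m.
  by apply: cover_ker; rewrite linearB linearMn /= coverU xE subrr.
exists (<< w >>, << x >>); apply: preim_val_inj; rewrite mk_linearE pE /=.
by rewrite coverU wE subrK.
Qed.

Lemma preim_mul_syzygy (phi : lmodType R -> Prop) (M : lmodType R) n : stable
    phi ->
  (forall j, Z_torsion_free (syzygy M j)) ->
  phi (syzygy (preim_mul M) n) -> phi (preim_mul (syzygy M n)).
Proof.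
move=> st; elim: n M => //= n IH M tf phiM; rewrite -iterS iterSr.
apply: IH => [j|]; first by move: (tf j.+1); rewrite /syzygy iterSr.
have [i [p ip]] := preim_mul_shift (tf 0%N) (tf 1%N).
apply/(stable_shift n st ip) => //.
by apply: projective_prod; apply: malg_projective.
Qed.

(** The map [(c, z) |-> m c + z] is onto, and its kernel consists of the pairs
    [(z, - m z)] because [U] has no torsion. *)
Lemma preim_mul_presentation (U : lmodType R) : Z_torsion_free U ->
  exists (i : {linear syzygy1 U -> ({malg R[U]} * syzygy1 U)%type})
    (p : {linear ({malg R[U]} * syzygy1 U)%type -> preim_mul U}),
    ses i p /\ forall z, i z = (sincl U z, - (z *+ m)).
Proof.
move=> tf.
have iL : linear (fun z : syzygy1 U =>
  (sincl U z, - (z *+ m)) : ({malg R[U]} * syzygy1 U)%type).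
  move=> k x y; congr (_, _); first by rewrite linearP.
  by rewrite /= mulrnDl opprD scalerN scalerMnr.
have /choice[p pE] : forall c : ({malg R[U]} * syzygy1 U)%type,
    exists z : preim_mul U, preim_val z = c.1 *+ m + sincl U c.2.
  move=> c; apply: (preim_mul_intro (u := cover c.1)).
  by rewrite linearD linearMn /= cover_sincl addr0.
have pL : linear p.
  move=> k x y; apply: preim_val_inj; rewrite linearP !pE /= !linearP /=.
  by rewrite mulrnDl scalerDr scalerMnr addrACA.
exists (mk_linear iL), (mk_linear pL); split=> //; split.
- by move=> x y [xy _]; apply: (@sincl_inj _ U).
- move=> [c z]; split=> [pcz|[w <-]]; last first.
    apply: preim_val_inj; rewrite !mk_linearE pE linear0 /=.
    by rewrite linearN linearMn subrr.
  have E : c *+ m + sincl U z = 0 by rewrite -(pE (c, z)) [p _]pcz linear0.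
  have [w wE] : exists w, sincl U w = c.
    apply: cover_ker; apply: (tf_mul_inj tf); rewrite mul0rn -linearMn.
    have -> : c *+ m = - sincl U z by apply/eqP; rewrite -addr_eq0 E.
    by rewrite linearN /= cover_sincl oppr0.
  exists w; rewrite mk_linearE wE; congr (_, _); apply: (@sincl_inj _ U).
  rewrite linearN linearMn /= wE; apply/eqP.
  by rewrite eq_sym -addr_eq0 addrC E.
move=> z; have [x xE] := preim_valP z.
have [w wE] : exists w, sincl U w = preim_val z - (<< x >> : {malg R[U]}) *+ m.
  by apply: cover_ker; rewrite linearB linearMn /= coverU xE subrr.
exists (<< x >>, w); apply: preim_val_inj; rewrite mk_linearE pE /=.
by rewrite wE addrC subrK.
Qed.

(** By [preim_mul_presentation] and the vanishing of [Tor_1 (I, preim_mul U)], an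
    element of [I (x) syzygy1 U] vanishes if both the inclusion and multiplication
    by [m] kill it. *)
Lemma Tor1_torsion (I : lmodType R^c) (U : lmodType R) : Z_torsion_free U ->
  Tor1_zero I (preim_mul U) ->
  forall t : tensor I (syzygy1 U), tensor_map (sincl U) t = 0 -> t *+ m = 0 ->
    t = 0.
Proof.
move=> tf tor t t0 tm; have [i [p [ip iE]]] := preim_mul_presentation tf.
apply: (Tor1_zero_inj ip tor).
pose D : lmodType R := ({malg R[U]} * syzygy1 U)%type.
have j1L : linear (fun c : {malg R[U]} => (c, 0) : D).
  by move=> k x y; congr (_, _); rewrite -[RHS]/(k *: 0 + 0) scaler0 addr0.
have j2L : linear (fun z : syzygy1 U => (0, z) : D).
  by move=> k x y; congr (_, _); rewrite -[RHS]/(k *: 0 + 0) scaler0 addr0.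
have mL : linear (fun z : syzygy1 U => - (z *+ m)).
  by move=> k x y; rewrite mulrnDl opprD scalerN scalerMnr.
rewrite (tensor_mapD (f := mk_linear j1L \o sincl U : {linear _ -> _})
  (g := mk_linear j2L \o mk_linear mL : {linear _ -> _})); last first.
  move=> z; rewrite iE /=; apply/esym; rewrite [LHS]surjective_pairing /=.
  by congr (_, _); rewrite ?addr0 ?add0r.
rewrite -(tensor_map_comp (f := sincl U) (g := mk_linear j1L)) // t0 raddf0
  add0r.
rewrite -(tensor_map_comp (f := mk_linear mL) (g := mk_linear j2L)) //.
suff -> : tensor_map (mk_linear mL) t = - (t *+ m) by rewrite tm oppr0 raddf0.
have mB : zmod_morphism (fun t : tensor I (syzygy1 U) => - (t *+ m)).
  by move=> x y; rewrite mulrnBl opprB opprK addrC.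
apply: (tensor_ext (g := mk_additive mB)) => x z.
rewrite [LHS](tensor_mapE (mk_linear mL) x z) mk_linearE mk_additiveE.
have tB : zmod_morphism (fun z : syzygy1 U => tens x z).
  by move=> y w; apply/eqP; rewrite eq_sym subr_eq -tensDr subrK.
by rewrite -[tens x _]/(mk_additive tB _) raddfN raddfMn.
Qed.

End DivisibleImage.

Section Final.
Variables (G : groupType) (n : nat).
Hypothesis extG : Ext_bound G n.
Local Notation R := (group_ring G).

Lemma torsion_free_syzygy (M : lmodType R) j :
  Z_torsion_free M -> Z_torsion_free (syzygy M j).
Proof.
case: j => // j _; apply: torsionless_torsion_free.
exact: (@torsionless_syzygy G (syzygy M j)).
Qed.

(** In degree [n + 1] the group is torsion by [rational_Ext], and torsion-free by
    [Tor1_torsion]; in higher degrees the syzygy of [M] is torsionless. *)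
Lemma coinduced_Tor (W : zmodType) (M : lmodType R) j : divisible W ->
  Z_torsion_free M -> (n <= j)%N ->
  Tor1_zero (rcoind idfun W : lmodType R^c) (syzygy M j).
Proof.
move=> W_div tfM; rewrite leq_eqVlt => /orP[/eqP <-|]; last first.
  case: j => // j nj; have -> : syzygy M j.+1 = syzygy (syzygy1 M) j.
    by rewrite /syzygy iterSr.
  exact: (torsionless_Tor extG W_div (@torsionless_syzygy G M) nj).
move=> t t0.
have [m m_gt0 tm] := Ext_dual_Tor_torsion (@rational_Ext G n extG W M) t0.
apply: (Tor1_torsion m_gt0 (torsion_free_syzygy (j := n) tfM) _ t0 tm).
apply: (preim_mul_syzygy m_gt0 (@Tor1_zero_stable _ _)).
  by move=> j'; apply: torsion_free_syzygy.
apply: (torsionless_Tor extG W_div _ (leqnn n)).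
apply: (torsionless_sub (@preim_val_inj R m M)).
exact: torsionless_malg (@torsionless_group_ring G).
Qed.

Lemma injective_divisible (I : lmodType R^c) : injective_module I ->
    divisible I.
Proof.
move=> I_inj m x m_gt0; pose Rc : lmodType R^c := (R^c)^o.
have fL : linear (fun r : Rc => r *+ m) by move=> a r s;
  rewrite mulrnDl scalerMnr.
have gL : linear (fun r : Rc => (r : R^c) *: x).
  by move=> a r s; rewrite scalerDl scalerA.
have f_inj : injective (mk_linear fL).
  move=> r s; apply: (tf_mul_inj m_gt0 (M := Rc)).
  exact/torsionless_torsion_free/(@torsionless_group_ring G).
have [h hE] := I_inj Rc Rc (mk_linear fL) (mk_linear gL) f_inj.
exists (h (1 : R^c)); rewrite -linearMn.
by have := hE (1 : R^c); rewrite !mk_linearE scale1r.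
Qed.

(** [I] embeds in the module coinduced from its underlying group, and splits off. *)
Lemma injective_Tor (I : lmodType R^c) (M : lmodType R) j : injective_module I
    ->
  Z_torsion_free M -> (n <= j)%N -> Tor1_zero I (syzygy M j).
Proof.
move=> I_inj tfM nj.
have sL : linear (fun x : I => (fun g => (gr g : R^c) *: x) : rcoind idfun I).
  apply: equivariant_linear_r => [x y|h x]; apply/funext => g.
    by rewrite scalerBr.
  by rewrite rcoind_scale scalerA grM.
have s_inj : injective (mk_linear sL).
  move=> x y xy; have := congr1 (fun f : rcoind idfun I => f 1%g) xy.
  by rewrite !mk_linearE gr1 !scale1r.
have [r rE] := I_inj I _ (mk_linear sL) idfun s_inj.
apply: (tensor_retract rE); apply: coinduced_Tor => //.
exact: injective_divisible.
Qed.

End Final.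

(** * The derived functors as homology groups *)

Lemma Tor_zero_homology (R : nzRingType) (I : lmodType R^c) (M : lmodType R) j :
  Tor1_zero I (syzygy M j) -> ~ zmod_nonzero (Tor j.+1 I M).
Proof.
move=> tor [v /eqP]; apply; rewrite -[v]reprK; move: (repr v) => z.
apply/eqP; rewrite -(raddf0 \pi_(Tor j.+1 I M)%qT) -Quotient.idealrBE subr0.
apply/asboolP.
have : tensor_map (@resolution_diff R M j) (val z) = 0 by apply/eqP;
  apply: (valP z).
move: (val z) => t t0.
have ct : tensor_map (@cover R (syzygy M j.+1)) t = 0.
  apply: tor; rewrite -[RHS]t0; apply: tensor_map_comp => c.
  by rewrite sinclE.
have [u uE] := tensor_right_exact (@cover_ker _ _) (@cover_surj _ _) ct.
have [w wE] := tensor_map_surj (I := I) (@cover_surj R (syzygy M j.+2)) u.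
exists w; rewrite -uE -wE; apply/esym/tensor_map_comp => c.
by rewrite sinclE.
Qed.

Lemma Ext_zero_homology (R : nzRingType) (M F : lmodType R) j :
  ~ zmod_nonzero (Ext j.+1 M F) -> Ext1_zero (syzygy M j) F.
Proof.
move=> ext h; pose S := syzygy M j.
have hcP : homp (h \o @cover R (syzygy1 S)) by apply/asboolP => a x y /=;
  rewrite !linearP.
pose k : hom (resolution M j.+1) F :=
  exist (fun f => homp f) (h \o @cover R (syzygy1 S)) hcP.
have kP : zkerp (@hom_map R _ _ F (@resolution_diff R M j.+1)) k.
  apply/eqP/val_inj/funext => c /=; rewrite /resolution_diff.
  by rewrite -(sinclE (cover c)) cover_sincl linear0.
pose z : zker (@hom_map R _ _ F (@resolution_diff R M j.+1)) :=
  exist (fun u => zkerp _ u) k kP.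
have : \pi_(Ext j.+1 M F)%qT z = 0.
  by apply: contrapT => /eqP nz; apply: ext; exists (\pi_(Ext j.+1 M F)%qT z).
rewrite -(raddf0 \pi_(Ext j.+1 M F)%qT) => /eqP.
rewrite -Quotient.idealrBE subr0 => /asboolP[e eE].
exists (mk_linear (asboolP _ (valP e))) => x.
have [c <-] := @cover_surj R (syzygy1 S) x.
have := congr1 (fun f : hom (resolution M j.+1) F => val f c) eE.
by rewrite mk_linearE sinclE /=.
Qed.

Lemma sup_nat_le (S T : set nat) :
  (forall n, (forall j, T j -> (j <= n)%N) -> forall i, S i -> (i <= n)%N) ->
  (sup_nat S <= sup_nat T)%E.
Proof.
move=> ST; have sup0 : sup_nat set0 = 0%:E by rewrite /sup_nat image_set0
  supremum0.
have [[m Tm]|unb] := pselect (exists m, forall j, T j -> (j <= m)%N).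
  have [n nT nsup] : exists2 n : nat, (forall j, T j -> (j <= n)%N) &
      ((n%:Z)%:E <= sup_nat T)%E.
    have [T0|T0] := pselect (T !=set0)%classic; last first.
      exists 0%N => [j Tj|]; first by case: T0; exists j.
      rewrite (_ : T = set0) ?sup0 //; apply: contrapT => /eqP/set0P [j Tj].
      by apply: T0; exists j.
    have exT : exists k, `[< T k >] by case: T0 => k Tk; exists k;
      apply/asboolP.
    have leT k : `[< T k >] -> (k <= m)%N by move/asboolP/Tm.
    have [k /asboolP Tk kmax] := ex_maxnP exT leT.
    exists k => [j Tj|]; first by apply: kmax; apply/asboolP.
    by apply: (sup_natP T0).1; exists k.
  apply: le_trans nsup; have [S0|S0] := pselect (S !=set0)%classic.
    apply: (sup_natP S0).2 => _ [i Si <-]; rewrite lee_fin lez_nat.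
    exact: ST nT i Si.
  rewrite (_ : S = set0) ?sup0 ?lee_fin //; apply: contrapT => /eqP/set0P[j Sj].
  by apply: S0; exists j.
have T0 : (T !=set0)%classic.
  apply: contrapT => T0; apply: unb; exists 0%N => j Tj.
  by case: T0; exists j.
have [ub _] := sup_natP T0; case E : (sup_nat T) ub => [z| |] ub.
- case: unb; exists `|z|%N => j Tj.
  have := ub _ (ex_intro2 _ _ j Tj erefl); rewrite lee_fin.
  by case: z {ub E} => // k; rewrite lez_nat.
- by rewrite leey.
- by case: T0 => j Tj; have := ub _ (ex_intro2 _ _ j Tj erefl).
Qed.

Theorem theorem1p5 (G : groupType) : (gen_hd G <= gen_cd G)%E.
Proof.
apply: sup_nat_le => n cd_n [//|j] [I [M [I_inj tfM torM]]].
rewrite ltnNge; apply/negP => nj; apply: Tor_zero_homology torM.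
apply: (injective_Tor (n := n)) => // L F k L_free F_free nk.
apply: Ext_zero_homology => extLF.
by have /cd_n : exists M F : lmodType (group_ring G),
  [/\ Z_free M, free_module F & zmod_nonzero (Ext k.+1 M F)];
  [exists L, F | rewrite ltnNge nk].
Qed.
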